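(* Fix $d\ge1$. There exist a nonnegative Lipschitz probability density $\mu:\mathbb{T}^d\to\mathbb{R}$ which vanishes only at one point and a family of probability densities $(\rho_\delta)_{\delta>0}$ on $\mathbb{T}^d$ such that $$\frac{\mathrm{MMD}^2(\rho_\delta,\mu)}{\mathsf{D}(\rho_\delta\mid\mu)}\longrightarrow+\infty\qquad\text{as }\delta\downarrow0.$$ In particular, for every $\varepsilon>0$ there exists a source density $\rho$ such that $\mathrm{MMD}^2(\rho,\mu)\ge\varepsilon^{-1}\mathsf{D}(\rho\mid\mu)$.
   Context: $\mathbb{T}^d$ is the flat torus, identified with $(-\frac12,\frac12)^d$ with periodic boundary conditions. $g$ is the periodic Coulomb kernel, $-\Delta g=\delta_0-1$ on $\mathbb{T}^d$. For probability densities $\rho,\mu$, $\mathrm{MMD}^2(\rho,\mu):=\frac12\int_{\mathbb{T}^d}g*(\rho-\mu)\,d(\rho-\mu)=\frac12\int_{\mathbb{T}^d}|\nabla g*(\rho-\mu)|^2\,dx$ and $\mathsf{D}(\rho\mid\mu):=\int_{\mathbb{T}^d}|\nabla g*(\rho-\mu)|^2\,d\rho$. *)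

(* Defs.v *)
From HB Require Import structures.
From mathcomp Require Export all_boot all_order all_algebra.
From mathcomp Require Export all_classical all_reals all_analysis.

Set Implicit Arguments.
Unset Strict Implicit.
Unset Printing Implicit Defensive.
Import Order.TTheory GRing.Theory Num.Theory.
Import numFieldNormedType.Exports.
Local Open Scope classical_set_scope.
Local Open Scope ring_scope.

(* Functions on the torus T^d are Z^d-periodic functions on 'rV[R]_d;          *)
(* differential calculus takes place on 'rV[R]_d, measure theory on            *)
(* d.-tuple R, which carries the product sigma-algebra.                        *)

Section lebesgue_tuple.
Context (R : realType).

Definition cons_pair n
    (p : (n.-tuple (measurableTypeR R)) * (measurableTypeR R)) :
  n.+1.-tuple (measurableTypeR R) := [tuple of p.2 :: p.1].

Lemma measurable_cons_pair n : measurable_fun [set: _] (@cons_pair n).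
Proof. exact: measurable_cons. Qed.

(* Image of the product measure m \x lambda under (t, a) |-> a :: t. The       *)
(* canonical instance is named because its measurability argument cannot be    *)
(* inferred.                                                                   *)
Definition lebesgue_cons n
    (m : {measure set (n.-tuple (measurableTypeR R)) -> \bar R}) :
    {measure set (n.+1.-tuple (measurableTypeR R)) -> \bar R} :=
  measure_function_pushforward__canonical__measure_function_Measure
    (m \x @lebesgue_measure R)%E (@measurable_cons_pair n).

Fixpoint lebesgue_tuple n :
    {measure set (n.-tuple (measurableTypeR R)) -> \bar R} :=
  match n with
  | 0 => \d_ [tuple]
  | m.+1 => lebesgue_cons (lebesgue_tuple m)
  end.

End lebesgue_tuple.

Section torus.
Context (R : realType) (d : nat).
Implicit Types (f g phi rho mu : 'rV[R]_d -> R) (x y : 'rV[R]_d).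

Definition row_of_tuple (t : d.-tuple (measurableTypeR R)) : 'rV[R]_d :=
  \row_i (tnth t i : R).

Definition cube : set (d.-tuple (measurableTypeR R)) :=
  [set t | forall i, (- 2^-1 < (tnth t i : R) < 2^-1)%R].

Definition lattice_vec (k : 'rV[int]_d) : 'rV[R]_d := map_mx intr k.

Definition periodic f := forall x k, f (x + lattice_vec k) = f x.

Definition torus_integrable f :=
  (lebesgue_tuple R d).-integrable cube (fun t => (f (row_of_tuple t))%:E).

Definition torus_eint f : \bar R :=
  (\int[lebesgue_tuple R d]_(t in cube) (f (row_of_tuple t))%:E)%E.

Definition torus_int f : R := fine (torus_eint f).

Definition pderive (i : 'I_d) f : 'rV[R]_d -> R := 'D_(delta_mx 0 i) f.

Definition laplacian f x : R := \sum_(i < d) pderive i (pderive i f) x.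

Fixpoint class_C n f : Prop :=
  match n with
  | 0 => continuous f
  | m.+1 => continuous f /\
      forall i : 'I_d,
        (forall x, derivable f x (delta_mx 0 i)) /\ class_C m (pderive i f)
  end.

Definition test_function phi := periodic phi /\ forall n, class_C n phi.

(* - Delta g = delta_0 - 1 on T^d in the sense of distributions; this          *)
(* determines g up to an a.e. modification and an additive constant, which     *)
(* does not change the convolution with a function of zero mean.               *)
Definition coulomb_kernel g :=
  [/\ periodic g, torus_integrable g &
    forall phi, test_function phi ->
      - torus_int (fun x => g x * laplacian phi x) = phi 0 - torus_int phi].

Definition weak_gradient g (G : 'I_d -> 'rV[R]_d -> R) :=
  forall i, [/\ periodic (G i), torus_integrable (G i) &
    forall phi, test_function phi ->
      torus_int (fun x => g x * pderive i phi x) =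
      - torus_int (fun x => G i x * phi x)].

Definition torus_conv f h x : R := torus_int (fun y => f (x - y) * h y).

Definition prob_density rho :=
  [/\ periodic rho, measurable_fun setT (rho \o row_of_tuple),
      (forall x, 0 <= rho x) & torus_eint rho = 1%E].

Definition MMD2 g rho mu : \bar R :=
  let f x := rho x - mu x in
  ((2^-1)%:E * torus_eint (fun x => (torus_conv g f x * f x)%R))%E.

(* G stands for nabla g. MMD2 and dissipation are extended-real-valued         *)
(* because they may be infinite for a merely integrable density.               *)
Definition dissipation (G : 'I_d -> 'rV[R]_d -> R) rho mu : \bar R :=
  let f x := rho x - mu x in
  torus_eint (fun x => (\sum_(i < d) torus_conv (G i) f x ^+ 2) * rho x).

End torus.

(* Main.v *)
From HB Require Import structures.
Require Import Defs.
From mathcomp Require Import measurable_realfun ring lra.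
Import Order.TTheory GRing.Theory Num.Theory.
Import numFieldNormedType.Exports.
Local Open Scope classical_set_scope.
Local Open Scope ring_scope.
Set Implicit Arguments.
Unset Strict Implicit.
Unset Printing Implicit Defensive.

(** If u is smooth on the torus and rho = mu - Lap u, then g * (rho - mu) is
    u minus its mean and grad g * (rho - mu) = grad u, because g is the Green
    function.  Hence MMD^2 = 1/2 int |grad u|^2 while
    D = int |grad u|^2 rho: the quotient is large as soon as |grad u|^2 lives
    where rho is small.  So let mu vanish at one point and let u be a tiny
    multiple of a bump w concentrated at that point.  Then rho is close to mu,
    and D / (2 MMD^2) is close to the mean value of mu for the weight
    |grad w|^2, which tends to 0 when the bump shrinks.

    Trigonometric polynomials suffice, so that no cut-off function is needed:
    mu is the average over i of 1 - cos (2 pi x_i), and w is the product over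
    i of ((1 + cos (2 pi x_i)) / 2) ^ N with N large.  Two facts carry the
    proof.

    - rho >= mu / 2, even near the zero of mu.  At its maximum w is concave, and
      [laplacian_peak_le] bounds Lap w by a multiple of mu everywhere.  A small
      multiple u of w therefore satisfies Lap u <= mu / 2.

    - The mean of 1 - cos (2 pi x_j) for the weight (d_i w)^2 is exactly
      1 / (2 N + 1), or 3 / (2 N + 1) when i = j ([int_concentration]).  The
      peak solves the first order equation
      sin (2 pi x_j) d_j w = - 2 pi N (1 - cos (2 pi x_j)) w, so the identity
      is the vanishing of the integral of d_j (sin (2 pi x_j) (d_i w)^2).

    The lower bound in the second fact matters too: it gives D > 0, once
    int (d_i w)^2 > 0 is known ([int_pderive_peak_gt0]).

    The convolution identities test the distributional equation for g against
    z |-> u (x - z), after the change of variables y |-> x - y on the torus.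
    The kernel is only known to be measurable on the open unit cube, so
    y |-> g (x - y) may fail to be measurable on a null set of shifted faces;
    [torus_eint_refl] deals with this.  It also yields the translation
    invariance of torus integrals, from which int d_i f = 0 follows by
    differentiating a constant integral with respect to the translation. *)

(** * Null sets and integrals over the circle *)

Section null.
Context d (T : measurableType d) (R : realType) (m : {measure set T -> \bar R}).
Local Open Scope ereal_scope.
Import HBNNSimple.

(** Valid without measurability of f and g: the integral is a supremum over
    simple functions below the integrand, and a simple function can be set to
    zero on N without changing its integral. *)
Lemma le_integral_off_null (N : set T) (f g : T -> \bar R) :
  measurable N -> m N = 0 -> (forall x, 0 <= f x) -> (forall x, 0 <= g x) ->
  (forall x, ~ N x -> f x <= g x) -> \int[m]_x f x <= \int[m]_x g x.
Proof.
move=> mN N0 f0 g0 fg.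
rewrite ge0_integralTE// ge0_integralTE//.
apply: ge_ereal_sup => _ [h hf <-].
pose h' := proj_nnsfun h (measurableC mN).
have -> : sintegral m h = sintegral m h'.
  rewrite -!(integralT_nnsfun m) /=.
  rewrite (ge0_negligible_integral mN) //; last 2 first.
  - apply/measurable_EFinP; exact: measurable_funP.
  - by move=> x _; rewrite lee_fin.
  rewrite setTD [RHS](ge0_negligible_integral mN) //; last 2 first.
  - apply/measurable_EFinP; rewrite -/(h' : T -> R); exact: (@measurable_funP _ _ _ _ setT h').
  - by move=> x _; rewrite lee_fin mulr_ge0// ?fun_ge0.
  rewrite setTD; apply: eq_integral => x xN.
  by rewrite /= /mindic indicE xN mulr1.
apply: ereal_sup_ubound; exists h' => // x /=.
rewrite /= /mindic indicE; have [xN|xN] := boolP (x \in ~` N); last by rewrite mulr0.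
rewrite mulr1; apply: le_trans (hf x) (fg x _).
by rewrite inE in xN.
Qed.

Lemma eq_integral_off_null (N D : set T) (f g : T -> \bar R) :
  measurable N -> m N = 0 -> {in D, forall x, ~ N x -> f x = g x} ->
  \int[m]_(x in D) f x = \int[m]_(x in D) g x.
Proof.
move=> mN N0 fg; rewrite integralE [RHS]integralE.
congr (_ - _); rewrite integral_mkcond [RHS]integral_mkcond.
- apply/eqP; rewrite eq_le; apply/andP; split;
   apply: (le_integral_off_null mN N0) => x; rewrite ?patchE.
  + by case: ifPn.
  + by case: ifPn.
  + by move=> Nx; case: ifPn => // xD; rewrite !funeposE fg.
  + by case: ifPn.
  + by case: ifPn.
  + by move=> Nx; case: ifPn => // xD; rewrite !funeposE fg.
- apply/eqP; rewrite eq_le; apply/andP; split;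
   apply: (le_integral_off_null mN N0) => x; rewrite ?patchE.
  + by case: ifPn.
  + by case: ifPn.
  + by move=> Nx; case: ifPn => // xD; rewrite !funenegE fg.
  + by case: ifPn.
  + by case: ifPn.
  + by move=> Nx; case: ifPn => // xD; rewrite !funenegE fg.
Qed.
End null.

Section circle.
Context (R : realType).
Notation mR := (measurableTypeR R).
Notation lam := (@lebesgue_measure R).
Implicit Types (a : R).

Lemma measurable_fun_refl a : measurable_fun [set: mR] (fun y : mR => a - y : mR).
Proof. by apply: measurable_funB => //; exact: measurable_id. Qed.

Lemma lebesgue_measure_refl a (A : set mR) : measurable A ->
  lam A = lam ((fun y => a - y) @^-1` A).
Proof.
move=> mA; pose m : {measure set mR -> \bar R} :=
  measure_function_pushforward__canonical__measure_function_Measure lam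
    (measurable_fun_refl a).
apply: (@lebesgue_measure_unique R m) => // X [[x y] xy] <-.
rewrite /m /= /pushforward /=.
rewrite (_ : _ @^-1` _ = `[a - y, a - x[%classic); last first.
  by apply/seteqP; split => z /=; rewrite !in_itv /= => /andP[? ?]; lra.
rewrite !lebesgue_measure_itv /= !lte_fin ltrD2l ltrN2.
by case: ifP => // _; rewrite -!EFinB; congr EFin; ring.
Qed.

Lemma ge0_integral_refl a (D : set mR) (f : mR -> \bar R) :
  measurable D -> measurable_fun [set: mR] f -> (forall x, 0 <= f x)%E ->
  (\int[lam]_(y in D) f (a - y)%R =
   \int[lam]_(y in (fun y => (a - y)%R) @^-1` D) f y)%E.
Proof.
move=> mD mf f0.
have mr := measurable_fun_refl a.
have mrD : measurable ((fun y : mR => a - y) @^-1` D).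
  by rewrite -[X in measurable X]setTI; exact: mr.
pose m : {measure set mR -> \bar R} :=
  measure_function_pushforward__canonical__measure_function_Measure lam mr.
rewrite (eq_measure_integral m) => [|A mA _]; last first.
  exact: lebesgue_measure_refl.
rewrite (@ge0_integral_pushforward _ _ _ _ R _ mr lam D)//.
  by apply: eq_integral => y _ /=; rewrite opprB addrC subrK.
by apply: measurable_funTS; exact: (measurableT_comp mf mr).
Qed.

(** The one-dimensional case of the open unit cube. *)
Definition circle_arc : set mR := [set y : mR | (- 2^-1 < (y : R) < 2^-1)%R].

Lemma circle_arcE : circle_arc = `]- 2^-1, 2^-1[%classic :> set R.
Proof. by apply/seteqP; split => y /=; rewrite in_itv. Qed.

Lemma measurable_circle_arc : measurable circle_arc.
Proof. by rewrite circle_arcE; exact: measurable_itv. Qed.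

(** Modulo integers a is r = a - floor a in [0, 1[.  The arc splits at r - 1/2:
    the reflection y |-> r - y maps the part above r - 1/2 into the arc, the
    reflection y |-> r - 1 - y the part below, and the two images tile the arc
    up to one point. *)
Lemma integral_circle_refl a (p : mR -> \bar R) :
  measurable_fun [set: mR] p -> (forall x, 0 <= p x)%E ->
  (forall y (k : int), p (y + k%:~R) = p y) ->
  (\int[lam]_(y in circle_arc) p (a - y)%R = \int[lam]_(y in circle_arc) p y)%E.
Proof.
move=> mp p0 pp; rewrite circle_arcE.
set k := Num.floor a; pose r := a - k%:~R : R.
have r0 : 0 <= r by rewrite subr_ge0 floor_le.
have r1 : r < 1 by have := floorD1_gt a; rewrite intrD /r -/k; lra.
have mpr b D : measurable_fun D (fun y : mR => p (b - y)%R).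
  by apply: measurable_funTS; exact: measurableT_comp mp (measurable_fun_refl b).
have split_arc q x y z : measurable_fun [set: mR] q -> (forall x, 0 <= q x)%E ->
    x <= y -> y < z ->
    (\int[lam]_(t in `]x, z[) q t =
     \int[lam]_(t in `]x, y]) q t + \int[lam]_(t in `]y, z[) q t)%E.
  move=> mq q0 xy yz.
  rewrite (@itv_bndbnd_setU _ _ _ (BRight y)) ?bnd_simp//.
  rewrite ge0_integral_setU//=.
  - exact: measurable_funTS.
  - by apply/disj_setPLR => t /=; rewrite !in_itv /= => /andP[? ?] /andP[? ?]; lra.
rewrite (split_arc _ (- 2^-1) (r - 2^-1) 2^-1 (mpr _ _)) //; [|lra|lra].
rewrite (_ : (\int[lam]_(t in `](- 2^-1)%R, (r - 2^-1)%R]) p (a - t)%R =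
   \int[lam]_(t in `](- 2^-1)%R, (r - 2^-1)%R]) p ((r - 1) - t)%R)%E); last first.
  apply: eq_integral => t _.
  by rewrite -[RHS](pp _ (k + 1)%Z) /r intrD; congr p; ring.
rewrite (_ : (\int[lam]_(t in `](r - 2^-1)%R, (2^-1)%R[) p (a - t)%R =
   \int[lam]_(t in `](r - 2^-1)%R, (2^-1)%R[) p (r - t)%R)%E); last first.
  apply: eq_integral => t _.
  by rewrite -[RHS](pp _ k) /r; congr p; ring.
rewrite !ge0_integral_refl//.
rewrite (_ : _ @^-1` _ = `[- 2^-1, r - 2^-1[%classic); last first.
  by apply/seteqP; split => z /=; rewrite !in_itv /= => /andP[? ?]; lra.
rewrite (_ : _ @^-1` _ = `]r - 2^-1, 2^-1[%classic); last first.
  by apply/seteqP; split => z /=; rewrite !in_itv /= => /andP[? ?]; lra.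
rewrite (split_arc _ (- 2^-1) (r - 2^-1) 2^-1)//; [|lra|lra].
congr (_ + _)%E.
rewrite [LHS]integral_itv_bndoo ?[RHS]integral_itv_bndoo//; exact: measurable_funTS.
Qed.
End circle.

(** * Integration over the cube by slicing *)

Section tuple_integral.
Context (R : realType).
Notation mR := (measurableTypeR R).
Notation lam := (@lebesgue_measure R).
Notation L n := (lebesgue_tuple R n).

Definition tuple_refl n (a : 'I_n -> R) (t : n.-tuple mR) : n.-tuple mR :=
  [tuple (a i - tnth t i : R) | i < n].

Definition tuple_shift n (t : n.-tuple mR) (k : 'I_n -> int) : n.-tuple mR :=
  [tuple ((tnth t i : R) + (k i)%:~R : R) | i < n].

Lemma tuple_refl_cons n a (t : n.-tuple mR) y :
  tuple_refl a (cons_pair (t, y)) =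
  cons_pair (tuple_refl (a \o lift ord0) t, a ord0 - y).
Proof.
apply: eq_from_tnth => i; rewrite tnth_mktuple.
by case: (unliftP ord0 i) => [j ->|->]; rewrite ?tnthS ?tnth_mktuple ?tnth0.
Qed.

Lemma tuple_shift_cons n k (t : n.-tuple mR) y :
  tuple_shift (cons_pair (t, y)) k =
  cons_pair (tuple_shift t (k \o lift ord0), (y : R) + (k ord0)%:~R).
Proof.
apply: eq_from_tnth => i; rewrite tnth_mktuple.
by case: (unliftP ord0 i) => [j ->|->]; rewrite ?tnthS ?tnth_mktuple ?tnth0.
Qed.

Lemma cube_cons n (t : n.-tuple mR) y :
  @cube R n.+1 (cons_pair (t, y)) <-> @cube R n t /\ circle_arc (y : mR).
Proof.
split=> [h|[h hy] i].
  split=> [i|]; first by have := h (lift ord0 i); rewrite tnthS.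
  by have := h ord0; rewrite tnth0.
by case: (unliftP ord0 i) => [j ->|->]; rewrite ?tnthS ?tnth0//; exact: h.
Qed.

Lemma measurable_mktuple d (T : measurableType d) n (f : 'I_n -> T -> mR) :
  (forall i, measurable_fun setT (f i)) ->
  measurable_fun setT (fun t => [tuple f i t | i < n]).
Proof.
move=> mf; apply/measurable_fun_tnthP => i.
by rewrite (_ : _ \o _ = f i)//; apply/funext => t /=; rewrite tnth_mktuple.
Qed.

Lemma measurable_tuple_refl n (a : 'I_n -> R) : measurable_fun setT (tuple_refl a).
Proof.
apply: measurable_mktuple => i.
exact: measurableT_comp (measurable_fun_refl (a i)) (measurable_tnth i).
Qed.

Definition box (r : R) n : set (n.-tuple mR) :=
  [set t | forall i, (- r < (tnth t i : R) < r)%R].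

Lemma measurable_box r n : measurable (@box r n).
Proof.
rewrite (_ : @box r n = \bigcap_(i in [set: 'I_n]) ((@tnth n mR)^~ i @^-1` `]- r, r[)).
  apply: fin_bigcap_measurable => [|i _]; first exact: finite_finset.
  by rewrite -[X in measurable X]setTI; apply: measurable_tnth.
apply/seteqP; split => t /= h i; first by move=> _ /=; rewrite in_itv/=; exact: h.
by have := h i I; rewrite /= in_itv.
Qed.

Lemma measurable_cube n : measurable (@cube R n).
Proof. exact: (@measurable_box 2^-1 n). Qed.

Lemma lebesgue_tuple_box r n : 0 < r -> L n (@box r n) = ((r *+ 2) ^+ n)%:E.
Proof.
move=> r0; elim: n => [|n IH].
  by rewrite /= diracE mem_set// => -[].
rewrite /= /pushforward (_ : _ @^-1` _ = @box r n `*` (`]- r, r[%classic : set mR)).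
  rewrite product_measure1E//; last exact: measurable_box.
  have lamE : lam `]- r, r[ = (r *+ 2)%:E.
    rewrite lebesgue_measure_itv /= lte_fin ifT; last lra.
    by rewrite -EFinB; congr EFin; ring.
  by rewrite [X in (X * _)%E]IH [X in (_ * X)%E]lamE -EFinM exprSr.
apply/seteqP; split => -[t y] /=.
  move=> h; split => [i|]; first by have := h (lift ord0 i); rewrite tnthS.
  by have := h ord0; rewrite tnth0 in_itv.
rewrite in_itv /= => -[h hy] i.
by case: (unliftP ord0 i) => [j ->|->]; rewrite ?tnthS ?tnth0//; exact: h.
Qed.

Lemma lebesgue_tuple_cube n : L n (@cube R n) = 1%E.
Proof.
rewrite (@lebesgue_tuple_box 2^-1) ?invr_gt0//.
have -> : (2^-1 : R) *+ 2 = 1 by rewrite mulr2n; lra.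
by rewrite expr1n.
Qed.

(** Needed for the product measures in Tonelli's theorem. *)
Lemma sigma_finite_lebesgue_tuple n : sigma_finite setT (L n).
Proof.
exists (fun k => @box k.+1%:R n) => [|k]; last first.
  by split; [exact: measurable_box|rewrite lebesgue_tuple_box ?ltry].
apply/seteqP; split => // t _.
pose M := \sum_(i < n) `|tnth t i : R|.
exists (Num.truncn M) => // i /=; rewrite -ltr_norml.
apply: le_lt_trans (truncnS_gt _).
by rewrite /M (bigD1 i)//= lerDl sumr_ge0.
Qed.

Section tonelli.
Context n (f : n.+1.-tuple mR -> \bar R).
Hypothesis mf : measurable_fun setT f.
Hypothesis f0 : forall t, (0 <= f t)%E.

Definition head_integral (t : n.-tuple mR) : \bar R :=
  (\int[lam]_(y in @circle_arc R) f (cons_pair (t, y)))%E.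

Let fI : n.-tuple mR * mR -> \bar R :=
  (fun p => f (cons_pair p)) \_ ([set: n.-tuple mR] `*` @circle_arc R).

Let mfI : measurable_fun setT fI.
Proof.
apply/(measurable_restrictT _ _).1.
  by apply: measurableX => //; exact: measurable_circle_arc.
by apply: measurable_funTS; exact: measurableT_comp mf (@measurable_cons_pair R n).
Qed.

Let fI0 p : (0 <= fI p)%E.
Proof. by rewrite /fI patchE; case: ifP. Qed.

Let head_integralE : head_integral = fubini_F lam fI.
Proof.
apply/funext => t; rewrite /head_integral /fubini_F [LHS]integral_mkcond.
apply: eq_integral => y _; rewrite /fI !patchE.
have -> // : ((t, y) \in [set: n.-tuple mR] `*` @circle_arc R) = (y \in @circle_arc R).
by apply/idP/idP; rewrite !inE => // -[].
Qed.

Lemma measurable_head_integral : measurable_fun setT head_integral.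
Proof. by rewrite head_integralE; exact: measurable_fun_fubini_tonelli_F. Qed.

Lemma head_integral_ge0 t : (0 <= head_integral t)%E.
Proof. by apply: integral_ge0 => y _. Qed.

(** Slicing: the head coordinate is integrated first.  Both the cube and the
    arc are turned into cut-offs of the integrand, since Tonelli's theorem is
    about integrals over the whole space. *)
Lemma integral_cube_cons :
  (\int[L n.+1]_(t in @cube R _) f t = \int[L n]_(t in @cube R _) head_integral t)%E.
Proof.
have mc := @measurable_cons_pair R n.
rewrite /= (@ge0_integral_pushforward _ _ _ _ R _ mc (L n \x lam)%E (@cube R n.+1))//; last 2 first.
- exact: measurable_cube.
- exact: measurable_funTS.
rewrite [LHS]integral_mkcond [RHS]integral_mkcond.
pose h : n.-tuple mR * mR -> \bar R := fI \_ (@cube R n `*` [set: mR]).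
have mh : measurable_fun setT h.
  apply/(measurable_restrictT _ _).1; last exact: measurable_funTS.
  by apply: measurableX => //; exact: measurable_cube.
have h0 p : (0 <= h p)%E by rewrite /h patchE; case: ifP.
transitivity (\int[(L n \x lam)%E]_p h p)%E.
  apply: eq_integral => -[t y] _; rewrite /h /fI !patchE.
  have -> : ((t, y) \in cons_pair (n:=n) @^-1` @cube R n.+1) =
      ((t, y) \in @cube R n `*` [set: mR]) &&
      ((t, y) \in [set: n.-tuple mR] `*` @circle_arc R).
    apply/idP/andP; rewrite !inE /=; first by move/cube_cons => [].
    by move=> [[? _] [_ ?]]; apply/cube_cons.
  by case: (_ \in @cube R n `*` _) => //=; case: ifP.
(* the same measure, bundled with its sigma-finiteness *)
pose sigmaf := isSigmaFinite.Build _ _ _ _ (@sigma_finite_lebesgue_tuple n).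
pose sf := isSFinite.Build _ _ _ _
  (sfinite_measure_sigma_finite (@sigma_finite_lebesgue_tuple n)).
pose m := HB.pack_for (SigmaFiniteMeasure.type (n.-tuple mR) R)
  (Measure.sort (L n)) sigmaf sf.
rewrite (@fubini_tonelli1 _ _ _ _ _ m lam)//.
apply: eq_integral => t _; rewrite patchE head_integralE /fubini_F /h.
have tc y : ((t, y) \in @cube R n `*` [set: mR]) = (t \in @cube R n).
  by apply/idP/idP; rewrite !inE => // -[].
case: ifPn => ht; first by apply: eq_integral => y _; rewrite patchE tc ht.
by rewrite integral0_eq// => y _; rewrite patchE tc (negbTE ht).
Qed.
End tonelli.

(** By induction on the dimension: the inner integral is invariant by the
    one-dimensional case, and as a function of the remaining coordinates it is
    again measurable, nonnegative and periodic. *)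
Lemma integral_cube_refl n (a : 'I_n -> R) (f : n.-tuple mR -> \bar R) :
  measurable_fun setT f -> (forall t, (0 <= f t)%E) ->
  (forall t k, f (tuple_shift t k) = f t) ->
  (\int[L n]_(t in @cube R _) f (tuple_refl a t) = \int[L n]_(t in @cube R _) f t)%E.
Proof.
elim: n a f => [|n IH] a f mf f0 fp.
  by apply: eq_integral => t _; rewrite (tuple0 t) (tuple0 (tuple_refl _ _)).
rewrite !integral_cube_cons//; last exact: measurableT_comp mf (measurable_tuple_refl a).
rewrite -(IH (a \o lift ord0) (head_integral f)); last 3 first.
- exact: measurable_head_integral.
- exact: head_integral_ge0.
- move=> t k; apply: eq_integral => y _.
  pose k' (i : 'I_n.+1) := if unlift ord0 i is Some j then k j else 0%Z.
  rewrite -(fp (cons_pair (t, y)) k') tuple_shift_cons /k' unlift_none addr0.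
  congr (f (cons_pair (_, _))); apply: eq_from_tnth => i.
  by rewrite !tnth_mktuple /= liftK.
apply: eq_integral => t _; rewrite /head_integral.
under eq_integral do rewrite tuple_refl_cons.
rewrite (integral_circle_refl (a ord0) (p := fun y => f (cons_pair (_, y))))//.
- apply: measurableT_comp mf _.
  apply: measurableT_comp (@measurable_cons_pair R n) _.
  exact: measurable_pair1.
- move=> y k.
  pose k' (i : 'I_n.+1) := if unlift ord0 i is Some j then 0%Z else k.
  rewrite -[RHS](fp _ k') tuple_shift_cons /k' unlift_none.
  congr (f (cons_pair (_, _))); apply: eq_from_tnth => i.
  by rewrite !tnth_mktuple /= liftK addr0.
Qed.

End tuple_integral.

(** * Torus integrals are invariant under reflections *)

Section torus_refl.
Context (R : realType) (d : nat).
Notation mR := (measurableTypeR R).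
Notation L := (lebesgue_tuple R d).
Notation cube := (@cube R d).

(** The representative modulo 1 in [-1/2, 1/2[. *)
Definition frac_part (y : mR) : mR := (y : R) - (Num.floor ((y : R) + 2^-1))%:~R.

Lemma measurable_frac_part : measurable_fun setT frac_part.
Proof.
apply: measurable_funB; first exact: measurable_id.
have mfl : measurable_fun setT (fun y : R => (Num.floor y)%:~R : R).
  apply: nondecreasing_measurable => [|x y xy] //.
  by rewrite ler_int floor_ge_int (le_trans (floor_le x)).
apply: (measurableT_comp mfl).
by apply: measurable_funD => //; exact: measurable_id.
Qed.

Lemma frac_part_id y : - 2^-1 < (y : R) < 2^-1 -> frac_part y = y.
Proof.
move=> /andP[h1 h2]; rewrite /frac_part (_ : Num.floor _ = 0) ?subr0//.
by apply: floor_def; rewrite add0r; apply/andP; split; lra.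
Qed.

Lemma frac_partDz y (k : int) : frac_part ((y : R) + k%:~R) = frac_part y.
Proof.
rewrite /frac_part (addrAC (y : R) k%:~R 2^-1) floorDrz ?intr_int// intrKfloor intrD.
by ring.
Qed.

Definition tuple_frac (t : d.-tuple mR) : d.-tuple mR :=
  [tuple frac_part (tnth t i) | i < d].

Lemma measurable_tuple_frac : measurable_fun setT tuple_frac.
Proof.
apply: measurable_mktuple => i.
exact: measurableT_comp measurable_frac_part (measurable_tnth i).
Qed.

Lemma tuple_frac_id t : cube t -> tuple_frac t = t.
Proof.
by move=> ct; apply: eq_from_tnth => i; rewrite tnth_mktuple frac_part_id//; exact: ct.
Qed.

Lemma tuple_frac_shift t k : tuple_frac (tuple_shift t k) = tuple_frac t.
Proof. by apply: eq_from_tnth => i; rewrite !tnth_mktuple frac_partDz. Qed.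

Lemma periodic_tuple_frac (f : 'rV[R]_d -> R) t : periodic f ->
  f (row_of_tuple (tuple_frac t)) = f (row_of_tuple t).
Proof.
move=> pf; pose k : 'rV[int]_d := \row_i (- Num.floor ((tnth t i : R) + 2^-1)).
rewrite -(pf (row_of_tuple t) k); congr f; apply/rowP => i.
by rewrite !mxE tnth_mktuple intrN.
Qed.

Lemma row_of_tuple_refl (x : 'rV[R]_d) t :
  row_of_tuple (tuple_refl (x 0) t) = x - row_of_tuple t.
Proof. by apply/rowP => i; rewrite !mxE tnth_mktuple. Qed.

Let mc := @measurable_cube R d.

(** The function f is replaced by the periodic extension F of its restriction
    to the open cube, put to 0 on the shifted faces; F is measurable
    everywhere and agrees with f off the faces.  The points of the cube that
    are reflected onto a face form a null set: reflection invariance, applied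
    to the indicator function of the faces, equates its measure with the
    measure of the part of the faces inside the open cube, which is empty. *)
Lemma torus_eint_refl (f : 'rV[R]_d -> R) (x : 'rV[R]_d) :
  periodic f -> measurable_fun cube (f \o @row_of_tuple R d) ->
  torus_eint (fun y => f (x - y)) = torus_eint f.
Proof.
move=> pf mf.
pose h : d.-tuple mR -> \bar R := (fun t => (f (row_of_tuple t))%:E) \_ cube.
have mh : measurable_fun setT h.
  apply/(measurable_restrictT _ _).1; first exact: mc.
  exact/measurable_EFinP.
pose F := h \o tuple_frac.
have mF : measurable_fun setT F by exact: measurableT_comp mh measurable_tuple_frac.
have mr := measurable_tuple_refl (x 0).
have Fp t k : F (tuple_shift t k) = F t by rewrite /F /= tuple_frac_shift.
have hcube t : cube (tuple_frac t) -> F t = (f (row_of_tuple t))%:E.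
  by move=> ct; rewrite /F /= /h patchE mem_set// periodic_tuple_frac.
pose B := [set t | ~ cube (tuple_frac (tuple_refl (x 0) t))].
have mB : measurable B.
  rewrite -[X in measurable X]setTI.
  exact: (measurableT_comp measurable_tuple_frac mr) (measurableC mc).
pose N := B `&` cube.
have mN : measurable N by exact: measurableI.
have N0 : L N = 0.
  pose g t : \bar R := (\1_(~` cube) (tuple_frac t) : R)%:E.
  have mg : measurable_fun setT g.
    apply/measurable_EFinP; apply: (measurableT_comp _ measurable_tuple_frac).
    exact: measurable_indic (measurableC mc).
  rewrite /N -(integral_indic _ mc mB).
  transitivity (\int[L]_(t in cube) g (tuple_refl (x 0%R) t))%E.
    apply: eq_integral => t _; rewrite /g !indicE.
    suff -> : (t \in B) = (tuple_frac (tuple_refl (x 0) t) \in ~` cube) by [].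
    by apply/idP/idP; rewrite !inE.
  rewrite integral_cube_refl//.
  - rewrite integral0_eq// => t ct; rewrite /g tuple_frac_id// indicE.
    by rewrite (memNset (A := ~` cube))// => /(_ ct).
  - by move=> t; rewrite /g lee_fin.
  - by move=> t k; rewrite /g tuple_frac_shift.
rewrite /torus_eint.
transitivity (\int[L]_(t in cube) F (tuple_refl (x 0%R) t))%E.
  apply: (eq_integral_off_null mN N0) => t; rewrite inE => ct Nt.
  rewrite hcube ?row_of_tuple_refl//.
  by apply: contrapT => Bt; apply: Nt.
transitivity (\int[L]_(t in cube) F t)%E; last first.
  apply: eq_integral => t; rewrite inE => ct.
  by rewrite hcube// tuple_frac_id.
rewrite integralE [RHS]integralE; congr (_ - _)%E.
- rewrite -(integral_cube_refl (x 0) (f := F^\+%E))//.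
  + by apply: eq_integral => t _; rewrite !funeposE.
  + exact: measurable_funepos.
  + by move=> t k; rewrite !funeposE Fp.
- rewrite -(integral_cube_refl (x 0) (f := F^\-%E))//.
  + by apply: eq_integral => t _; rewrite !funenegE.
  + exact: measurable_funeneg.
  + by move=> t k; rewrite !funenegE Fp.
Qed.
End torus_refl.

(** * Trigonometric polynomials *)

Lemma periodz (R : realType) (h : R -> R) (T a : R) (k : int) :
  (forall t, h (t + T) = h t) -> h (a + T * k%:~R) = h a.
Proof.
move=> hp; have hn n b : h (b + T * n%:R) = h b.
  elim: n => [|n IH]; first by rewrite mulr0 addr0.
  by rewrite -natr1 mulrDr mulr1 addrA hp.
case: k => n; first exact: hn.
by rewrite NegzE -[RHS](hn n.+1 a) -[LHS](hn n.+1) mulrNz mulrN addrNK hn.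
Qed.

(** Reduce to the fractional part b of a and use
    cos (2 pi b) = 1 - 2 sin^2 (pi b), where sin (pi b) > 0 for 0 < b < 1. *)
Lemma cos_2pi_eq1 (R : realType) (a : R) : cos (pi *+ 2 * a) = 1 -> exists k : int, a = k%:~R.
Proof.
move=> ca; exists (Num.floor a); set b := a - (Num.floor a)%:~R.
suff : b = 0 by rewrite /b => /eqP; rewrite subr_eq0 => /eqP.
have cb : cos (pi *+ 2 * b) = 1.
  by rewrite -ca -(periodz (pi *+ 2 * b) (Num.floor a) (@cosD2pi R)) -mulrDr subrK.
have b0 : 0 <= b by rewrite subr_ge0 floor_le.
have b1 : b < 1 by have := floorD1_gt a; rewrite intrD /b; lra.
apply/eqP; apply: contraTT isT => bN0.
have bp : 0 < b by rewrite lt0r bN0.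
have sp : 0 < sin (pi * b).
  apply: sin_gt0_pi; rewrite mulr_gt0 ?pi_gt0//=.
  by rewrite gtr_pMr// pi_gt0.
move: cb; rewrite mulrnAl cos_mulr2n => cb.
have := cos2sin2 (pi * b); move: (exprn_gt0 2 sp) => s2 c2.
by move: cb; rewrite c2 mulr2n; lra.
Qed.

Section trigpoly.
Context (R : realType) (d : nat).
Implicit Types (f g : 'rV[R]_d -> R) (x y z : 'rV[R]_d).
Notation e i := (delta_mx 0 i : 'rV[R]_d).
Notation tau := (pi *+ 2 : R).

Definition cosc (i : 'I_d) x : R := cos (tau * x 0 i).
Definition sinc (i : 'I_d) x : R := sin (tau * x 0 i).

(** An inductive predicate, so that smoothness, periodicity, boundedness and the
    symmetry of second derivatives can be proved by induction on the
    construction of f. *)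
Inductive trigpoly : ('rV[R]_d -> R) -> Prop :=
| trigpoly_cst c : trigpoly (fun=> c)
| trigpoly_cos i : trigpoly (cosc i)
| trigpoly_sin i : trigpoly (sinc i)
| trigpolyD f g : trigpoly f -> trigpoly g -> trigpoly (fun x => f x + g x)
| trigpolyM f g : trigpoly f -> trigpoly g -> trigpoly (fun x => f x * g x).

Lemma trigpolyZ c f : trigpoly f -> trigpoly (fun x => c * f x).
Proof. by move=> tf; exact: trigpolyM (trigpoly_cst c) tf. Qed.

Lemma trigpolyN f : trigpoly f -> trigpoly (fun x => - f x).
Proof.
move=> tf; rewrite (_ : (fun _ => _) = (fun x => -1 * f x)); first exact: trigpolyZ.
by apply/funext => x; rewrite mulN1r.
Qed.

Lemma trigpolyB f g : trigpoly f -> trigpoly g -> trigpoly (fun x => f x - g x).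
Proof. by move=> tf tg; apply: trigpolyD => //; exact: trigpolyN. Qed.

Lemma trigpolyX n f : trigpoly f -> trigpoly (fun x => f x ^+ n).
Proof.
move=> tf; elim: n => [|n IH]; first exact: trigpoly_cst.
rewrite (_ : (fun _ => _) = (fun x => f x * f x ^+ n)); first exact: trigpolyM.
by apply/funext => x; rewrite exprS.
Qed.

Lemma trigpoly_sum (I : Type) (s : seq I) (P : pred I) (F : I -> 'rV[R]_d -> R) :
  (forall i, trigpoly (F i)) -> trigpoly (fun x => \sum_(i <- s | P i) F i x).
Proof.
move=> tF; elim: s => [|i s IH].
  by under eq_fun do rewrite big_nil; exact: trigpoly_cst.
under eq_fun do rewrite big_cons.
by case: (P i) => //; exact: trigpolyD.
Qed.

Lemma trigpoly_prod (I : Type) (s : seq I) (P : pred I) (F : I -> 'rV[R]_d -> R) :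
  (forall i, trigpoly (F i)) -> trigpoly (fun x => \prod_(i <- s | P i) F i x).
Proof.
move=> tF; elim: s => [|i s IH].
  by under eq_fun do rewrite big_nil; exact: trigpoly_cst.
under eq_fun do rewrite big_cons.
by case: (P i) => //; exact: trigpolyM.
Qed.

Lemma trigpoly_periodic f : trigpoly f -> periodic f.
Proof.
elim=> [//|i|i|{}f g _ IHf _ IHg|{}f g _ IHf _ IHg] x k; last 2 first.
- by rewrite IHf IHg.
- by rewrite IHf IHg.
- by rewrite /cosc !mxE mulrDr periodz//; exact: cosD2pi.
- by rewrite /sinc !mxE mulrDr periodz//; exact: sinD2pi.
Qed.

Lemma trigpoly_refl f x : trigpoly f -> trigpoly (fun z => f (x - z)).
Proof.
elim=> [c|i|i|{}f g _ IHf _ IHg|{}f g _ IHf _ IHg].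
- exact: trigpoly_cst.
- rewrite (_ : (fun _ => _) = (fun z => cosc i x * cosc i z + sinc i x * sinc i z)).
    by apply: trigpolyD; apply: trigpolyZ; [exact: trigpoly_cos|exact: trigpoly_sin].
  by apply/funext => z; rewrite /cosc /sinc !mxE mulrBr cosB.
- rewrite (_ : (fun _ => _) = (fun z => sinc i x * cosc i z - cosc i x * sinc i z)).
    by apply: trigpolyB; apply: trigpolyZ; [exact: trigpoly_cos|exact: trigpoly_sin].
  by apply/funext => z; rewrite /cosc /sinc !mxE mulrBr sinB.
- exact: trigpolyD.
- exact: trigpolyM.
Qed.

Lemma trigpoly_measurable f : trigpoly f ->
  measurable_fun setT (f \o @row_of_tuple R d).
Proof.
have mco i : measurable_fun setT
    (fun t : d.-tuple (measurableTypeR R) => tau * (row_of_tuple t) 0 i).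
  apply: measurable_funM => //.
  rewrite (_ : (fun _ => _) = (fun t => tnth t i)); first exact: measurable_tnth.
  by apply/funext => t; rewrite mxE.
elim=> [c|i|i|{}f g _ IHf _ IHg|{}f g _ IHf _ IHg].
- exact: measurable_cst.
- apply: (measurableT_comp _ (mco i)).
  exact: continuous_measurable_fun (@continuous_cos R).
- apply: (measurableT_comp _ (mco i)).
  exact: continuous_measurable_fun (@continuous_sin R).
- exact: measurable_funD.
- exact: measurable_funM.
Qed.

Lemma trigpoly_bounded f : trigpoly f -> exists M, forall x, `|f x| <= M.
Proof.
elim=> [c|i|i|{}f g _ [Mf IHf] _ [Mg IHg]|{}f g _ [Mf IHf] _ [Mg IHg]].
- by exists `|c|.
- by exists 1 => x; exact: cos_max.
- by exists 1 => x; exact: sin_max.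
- by exists (Mf + Mg) => x; rewrite (le_trans (ler_normD _ _))// lerD.
- by exists (Mf * Mg) => x; rewrite normrM ler_pM.
Qed.

Lemma normr_coord_le x i : `|x 0 i| <= `|x|.
Proof.
rewrite [`|x|]/Num.norm /= mx_normrE.
exact: (@le_bigmax _ _ _ _ (fun ij : 'I_1 * 'I_d => `|x ij.1 ij.2|) (0, i)).
Qed.

(** By the mean value theorem for sine and cosine; a product is Lipschitz
    because its factors are bounded. *)
Lemma trigpoly_lipschitz f : trigpoly f ->
  exists2 K, 0 <= K & forall x y, `|f x - f y| <= K * `|x - y|.
Proof.
have mvt (h dh : R -> R) : (forall u : R, is_derive u (1 : R) h (dh u)) ->
    (forall u, `|dh u| <= 1) -> forall a b, `|h a - h b| <= `|a - b|.
  move=> hd dh1 a b; wlog ab : a b / a <= b.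
    by move=> H; have [|/ltW] := leP a b => ab; [|rewrite distrC (distrC a)]; exact: H.
  have [|c _] := @MVT_segment _ h dh _ _ ab (fun u _ => hd u).
    apply: continuous_subspaceT => u; apply: differentiable_continuous.
    by apply/derivable1_diffP; case: (hd u).
  by rewrite distrC (distrC a) => ->; rewrite normrM ler_piMl.
have mvti (h dh : R -> R) i x y : (forall u : R, is_derive u (1 : R) h (dh u)) ->
    (forall u, `|dh u| <= 1) ->
    `|h (tau * x 0 i) - h (tau * y 0 i)| <= tau * `|x - y|.
  move=> hd dh1; apply: (le_trans (mvt _ _ hd dh1 _ _)).
  have tau0 : 0 <= tau by rewrite mulrn_wge0// pi_ge0.
  rewrite -mulrBr normrM ger0_norm// ler_wpM2l//.
  by have := normr_coord_le (x - y) i; rewrite !mxE.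
have tau0 : 0 <= tau by rewrite mulrn_wge0// pi_ge0.
elim=> [c|i|i|{}f g _ [Kf Kf0 IHf] _ [Kg Kg0 IHg]|
        {}f g tf [Kf Kf0 IHf] tg [Kg Kg0 IHg]].
- by exists 0 => // x y; rewrite subrr normr0 mul0r.
- exists tau => // x y; apply: (mvti (@cos R) (fun u => - sin u)) => u.
  by rewrite normrN; exact: sin_max.
- exists tau => // x y; apply: (mvti (@sin R) (@cos R)) => u.
  exact: cos_max.
- exists (Kf + Kg); first exact: addr_ge0.
  move=> x y; rewrite mulrDl opprD addrACA.
  by rewrite (le_trans (ler_normD _ _))// lerD.
- have [Mf hMf] := trigpoly_bounded tf; have [Mg hMg] := trigpoly_bounded tg.
  have Mf0 : 0 <= Mf by exact: le_trans (hMf 0).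
  have Mg0 : 0 <= Mg by exact: le_trans (hMg 0).
  exists (Mf * Kg + Mg * Kf); first by rewrite addr_ge0// mulr_ge0.
  move=> x y.
  have -> : f x * g x - f y * g y = f x * (g x - g y) + g y * (f x - f y) by ring.
  rewrite (le_trans (ler_normD _ _))// !normrM mulrDl -!mulrA.
  by apply: lerD; apply: ler_pM.
Qed.

Lemma trigpoly_continuous f : trigpoly f -> continuous f.
Proof.
have cco i : continuous (fun x => tau * x 0 i).
  move=> x; apply: (@continuousM R 'rV[R]_d (fun=> tau) (fun y => y 0 i) x).
    exact: cst_continuous.
  exact: coord_continuous.
elim=> [c|i|i|{}f g _ IHf _ IHg|{}f g _ IHf _ IHg] x.
- exact: cst_continuous.
- exact: (@continuous_comp _ _ _ (fun y : 'rV[R]_d => tau * y 0 i) (@cos R) x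
    (cco i x) (@continuous_cos R _)).
- exact: (@continuous_comp _ _ _ (fun y : 'rV[R]_d => tau * y 0 i) (@sin R) x
    (cco i x) (@continuous_sin R _)).
- exact: (continuousD (IHf x) (IHg x)).
- exact: (continuousM (IHf x) (IHg x)).
Qed.

(** Directional derivatives are one-variable derivatives along a line; this
    gives access to the chain rule for functions of a real variable. *)
Lemma is_derive_line f x v df :
  is_derive (0 : R) 1 (fun h : R => f (h *: v + x)) df -> is_derive x v f df.
Proof.
move=> [hd hv].
have E : (fun h : R => h^-1 *: (((fun h : R => f (h *: v + x)) \o shift 0) (h *: 1)
    - (fun h : R => f (h *: v + x)) 0)) =
    (fun h : R => h^-1 *: ((f \o shift x) (h *: v) - f x)).
  by apply/funext => h /=; rewrite addr0 scale0r add0r [h *: 1]mulr1.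
by split; [rewrite /derivable -E|rewrite /derive -E].
Qed.

Lemma is_derive_affine (a b t : R) : is_derive t (1 : R) (fun h : R => a * h + b) a.
Proof.
apply: (is_derive_eq (is_deriveD (is_deriveZ a (is_derive_id t 1)) (is_derive_cst b t 1))).
by rewrite addr0 [_ *: _]mulr1.
Qed.

Lemma is_derive_cosc i j x :
  is_derive x (e i) (cosc j) (- tau * sinc j x * (i == j)%:R).
Proof.
apply: is_derive_line; set b := (i == j)%:R.
rewrite (_ : (fun _ => _) = (@cos R) \o (fun h => (tau * b) * h + tau * x 0 j)); last first.
  by apply/funext => h; rewrite /cosc /= !mxE eqxx /= eq_sym -/b; congr cos; ring.
apply: (is_derive_eq (is_derive1_comp (is_derive_cos _) (is_derive_affine _ _ _))).
by rewrite mulr0 add0r /sinc; ring.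
Qed.

Lemma is_derive_sinc i j x :
  is_derive x (e i) (sinc j) (tau * cosc j x * (i == j)%:R).
Proof.
apply: is_derive_line; set b := (i == j)%:R.
rewrite (_ : (fun _ => _) = (@sin R) \o (fun h => (tau * b) * h + tau * x 0 j)); last first.
  by apply/funext => h; rewrite /sinc /= !mxE eqxx /= eq_sym -/b; congr sin; ring.
apply: (is_derive_eq (is_derive1_comp (is_derive_sin _) (is_derive_affine _ _ _))).
by rewrite mulr0 add0r /cosc; ring.
Qed.

Lemma is_derive_pderive f i g : (forall x, is_derive x (e i) f (g x)) ->
  pderive i f = g.
Proof. by move=> fg; apply/funext => x; case: (fg x). Qed.

Lemma trigpoly_is_derive f i x : trigpoly f ->
  is_derive x (e i) f (pderive i f x).
Proof.
move=> tf; suff [g hg] : exists g, forall x, is_derive x (e i) f (g x).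
  by rewrite (is_derive_pderive hg).
elim: tf => [c|j|j|{x}f' g' _ [df hf] _ [dg hg]|{x}f' g' _ [df hf] _ [dg hg]].
- by exists (fun=> 0) => y; exact: is_derive_cst.
- by exists (fun y => - tau * sinc j y * (i == j)%:R) => y; exact: is_derive_cosc.
- by exists (fun y => tau * cosc j y * (i == j)%:R) => y; exact: is_derive_sinc.
- by exists (fun y => df y + dg y) => y; exact: (is_deriveD (hf y) (hg y)).
- by exists (fun y => f' y * dg y + g' y * df y) => y; exact: (is_deriveM (hf y) (hg y)).
Qed.

Lemma pderive_cst i (c : R) : pderive i (fun _ : 'rV[R]_d => c) = fun=> 0.
Proof. by apply: is_derive_pderive => x; exact: is_derive_cst. Qed.

Lemma pderiveD i f g : trigpoly f -> trigpoly g ->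
  pderive i (fun x => f x + g x) = fun x => pderive i f x + pderive i g x.
Proof.
move=> tf tg; apply: is_derive_pderive => x.
exact: (is_deriveD (trigpoly_is_derive i x tf) (trigpoly_is_derive i x tg)).
Qed.

Lemma pderiveM i f g : trigpoly f -> trigpoly g ->
  pderive i (fun x => f x * g x) = fun x => pderive i f x * g x + f x * pderive i g x.
Proof.
move=> tf tg; apply: is_derive_pderive => x; apply: is_derive_eq.
  exact: (is_deriveM (trigpoly_is_derive i x tf) (trigpoly_is_derive i x tg)).
by rewrite /GRing.scale /=; ring.
Qed.

Lemma pderiveZ i c f : trigpoly f ->
  pderive i (fun x => c * f x) = fun x => c * pderive i f x.
Proof.
move=> tf; rewrite pderiveM//; last exact: trigpoly_cst.
by apply/funext => x; rewrite pderive_cst mul0r add0r.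
Qed.

Lemma pderiveN i f : trigpoly f ->
  pderive i (fun x => - f x) = fun x => - pderive i f x.
Proof.
move=> tf; rewrite (_ : (fun x => - f x) = (fun x => -1 * f x)); last first.
  by apply/funext => x; rewrite mulN1r.
by rewrite pderiveZ//; apply/funext => x; rewrite mulN1r.
Qed.

Lemma pderiveX i m f : trigpoly f ->
  pderive i (fun x => f x ^+ m) = fun x => m%:R * f x ^+ m.-1 * pderive i f x.
Proof.
move=> tf; elim: m => [|m IH].
  under eq_fun do rewrite expr0.
  by rewrite pderive_cst; apply/funext => x; rewrite !mul0r.
rewrite (_ : (fun x => f x ^+ m.+1) = (fun x => f x * f x ^+ m)); last first.
  by apply/funext => x; rewrite exprS.
rewrite (pderiveM i tf (trigpolyX m tf)) IH; apply/funext => x /=.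
case: m {IH} => [|m]; first by rewrite /= !expr0 mul0r mulr1 mul0r mulr0 addr0 !mul1r.
by rewrite /= exprS -[m.+2]addn1 natrD; ring.
Qed.

Lemma pderive_cosc i j :
  pderive i (cosc j) = fun x => - tau * sinc j x * (i == j)%:R.
Proof. by apply: is_derive_pderive => x; exact: is_derive_cosc. Qed.

Lemma pderive_sinc i j :
  pderive i (sinc j) = fun x => tau * cosc j x * (i == j)%:R.
Proof. by apply: is_derive_pderive => x; exact: is_derive_sinc. Qed.

Lemma trigpoly_pderive i f : trigpoly f -> trigpoly (pderive i f).
Proof.
elim=> [c|j|j|{}f g tf IHf tg IHg|{}f g tf IHf tg IHg].
- by rewrite pderive_cst; exact: trigpoly_cst.
- rewrite pderive_cosc; apply: trigpolyM; last exact: trigpoly_cst.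
  by apply: trigpolyZ; exact: trigpoly_sin.
- rewrite pderive_sinc; apply: trigpolyM; last exact: trigpoly_cst.
  by apply: trigpolyZ; exact: trigpoly_cos.
- by rewrite pderiveD//; exact: trigpolyD.
- by rewrite pderiveM//; apply: trigpolyD; exact: trigpolyM.
Qed.

Lemma pderiveC i j f : trigpoly f -> pderive i (pderive j f) = pderive j (pderive i f).
Proof.
have key (k l m : 'I_d) : (k == m)%:R * (l == m)%:R = (l == m)%:R * (k == m)%:R :> R.
  exact: mulrC.
elim=> [c|k|k|{}f g tf IHf tg IHg|{}f g tf IHf tg IHg].
- by rewrite !pderive_cst.
- rewrite !pderive_cosc.
  have H (b : R) l : pderive l (fun x => - tau * sinc k x * b) =
      fun x => - tau * (tau * cosc k x * (l == k)%:R) * b.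
    rewrite (_ : (fun x => - tau * sinc k x * b) = (fun x => (- tau * b) * sinc k x)).
      rewrite pderiveZ; last exact: trigpoly_sin.
      by rewrite pderive_sinc; apply/funext => x; ring.
    by apply/funext => x; ring.
  by rewrite !H; apply/funext => x; ring.
- rewrite !pderive_sinc.
  have H (b : R) l : pderive l (fun x => tau * cosc k x * b) =
      fun x => tau * (- tau * sinc k x * (l == k)%:R) * b.
    rewrite (_ : (fun x => tau * cosc k x * b) = (fun x => (tau * b) * cosc k x)).
      rewrite pderiveZ; last exact: trigpoly_cos.
      by rewrite pderive_cosc; apply/funext => x; ring.
    by apply/funext => x; ring.
  by rewrite !H; apply/funext => x; ring.
- have H k l : pderive k (pderive l (fun x => f x + g x)) =
      fun x => pderive k (pderive l f) x + pderive k (pderive l g) x.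
    by rewrite (pderiveD l tf tg) (pderiveD k (trigpoly_pderive l tf) (trigpoly_pderive l tg)).
  by rewrite !H IHf IHg.
- have tdf k := trigpoly_pderive k tf; have tdg k := trigpoly_pderive k tg.
  have H k l : pderive k (pderive l (fun x => f x * g x)) = fun x =>
      pderive k (pderive l f) x * g x + pderive l f x * pderive k g x +
      (pderive k f x * pderive l g x + f x * pderive k (pderive l g) x).
    rewrite (pderiveM l tf tg) (pderiveD k (trigpolyM (tdf l) tg) (trigpolyM tf (tdg l))).
    by rewrite (pderiveM k (tdf l) tg) (pderiveM k tf (tdg l)).
  by rewrite !H IHf IHg; apply/funext => x; ring.
Qed.

Lemma trigpoly_test_function f : trigpoly f -> test_function f.
Proof.
move=> tf; split; first exact: trigpoly_periodic.
move=> n; elim: n f tf => [|n IH] f tf; first exact: trigpoly_continuous.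
split; first exact: trigpoly_continuous.
move=> i; split; last by apply: IH; exact: trigpoly_pderive.
by move=> x; case: (trigpoly_is_derive i x tf).
Qed.

Lemma pderive_refl i f x : trigpoly f ->
  pderive i (fun z => f (x - z)) = fun z => - pderive i f (x - z).
Proof.
elim=> [c|j|j|{}f g tf IHf tg IHg|{}f g tf IHf tg IHg].
- by rewrite !pderive_cst; apply/funext => z; rewrite oppr0.
- rewrite (_ : (fun z => _) = (fun z => cosc j x * cosc j z + sinc j x * sinc j z)).
    have tc := trigpoly_cos j; have ts := trigpoly_sin j.
    rewrite pderiveD ?pderiveZ//; try exact: trigpolyZ.
    rewrite !pderive_cosc pderive_sinc; apply/funext => z.
    by rewrite /cosc /sinc !mxE mulrBr sinB; ring.
  by apply/funext => z; rewrite /cosc /sinc !mxE mulrBr cosB.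
- rewrite (_ : (fun z => _) = (fun z => sinc j x * cosc j z + (- cosc j x) * sinc j z)).
    have tc := trigpoly_cos j; have ts := trigpoly_sin j.
    rewrite pderiveD ?pderiveZ//; try exact: trigpolyZ.
    rewrite !pderive_cosc !pderive_sinc; apply/funext => z.
    by rewrite /cosc /sinc !mxE mulrBr cosB; ring.
  by apply/funext => z; rewrite /cosc /sinc !mxE mulrBr sinB mulNr.
- rewrite [in RHS]pderiveD// (pderiveD i (trigpoly_refl x tf) (trigpoly_refl x tg)).
  by rewrite IHf IHg; apply/funext => z; rewrite opprD.
- rewrite [in RHS]pderiveM// (pderiveM i (trigpoly_refl x tf) (trigpoly_refl x tg)).
  by rewrite IHf IHg; apply/funext => z; ring.
Qed.

Lemma trigpoly_laplacian f : trigpoly f -> trigpoly (laplacian f).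
Proof.
by move=> tf; apply: trigpoly_sum => i; do 2 apply: trigpoly_pderive.
Qed.

Lemma pderive_sum (I : Type) (s : seq I) (F : I -> 'rV[R]_d -> R) i :
  (forall j, trigpoly (F j)) ->
  pderive i (fun x => \sum_(j <- s) F j x) = fun x => \sum_(j <- s) pderive i (F j) x.
Proof.
move=> tF; elim: s => [|j s IH].
  by under eq_fun do rewrite big_nil; rewrite pderive_cst; apply/funext => x; rewrite big_nil.
under eq_fun do rewrite big_cons.
rewrite pderiveD ?IH//; last exact: trigpoly_sum.
by apply/funext => x; rewrite big_cons.
Qed.

Lemma pderive_laplacian i f : trigpoly f ->
  pderive i (laplacian f) = laplacian (pderive i f).
Proof.
move=> tf; have tj j : trigpoly (pderive j (pderive j f)).
  by do 2 apply: trigpoly_pderive.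
transitivity (fun x => \sum_(j < d) pderive i (pderive j (pderive j f)) x).
  exact: (pderive_sum _ i tj).
apply/funext => x; apply: eq_bigr => j _.
by rewrite (pderiveC i j (trigpoly_pderive j tf)) (pderiveC i j tf).
Qed.

End trigpoly.

(** * Integration by parts on the torus and convolution with the kernel *)

Section torus_int.
Context (R : realType) (d : nat).
Implicit Types (f g h u : 'rV[R]_d -> R) (x y z : 'rV[R]_d).
Notation e i := (delta_mx 0 i : 'rV[R]_d).
Notation L := (lebesgue_tuple R d).
Notation cube := (@cube R d).

Let mc := @measurable_cube R d.

Lemma torus_intE f : torus_int f = Rintegral L cube (f \o @row_of_tuple R d).
Proof. by []. Qed.

Lemma trigpoly_integrable f : trigpoly f -> torus_integrable f.
Proof.
move=> tf; have [M hM] := trigpoly_bounded tf.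
apply: (measurable_bounded_integrable (f := f \o @row_of_tuple R d)) => //.
- by rewrite lebesgue_tuple_cube ltry.
- by apply: measurable_funTS; exact: trigpoly_measurable.
- exists M; split; first exact: num_real.
  by move=> N MN t _ /=; rewrite (le_trans (hM _))// ltW.
Qed.

Lemma torus_eint_trigpoly f : trigpoly f -> torus_eint f = (torus_int f)%:E.
Proof.
move=> tf; rewrite fineK//.
exact: (integrable_fin_num mc (trigpoly_integrable tf)).
Qed.

Lemma torus_int_cst c : torus_int (fun _ : 'rV[R]_d => c) = c.
Proof.
by rewrite torus_intE Rintegral_cst//= lebesgue_tuple_cube mulr1.
Qed.

Lemma torus_intD f g : trigpoly f -> trigpoly g ->
  torus_int (fun x => f x + g x) = torus_int f + torus_int g.
Proof.
by move=> /trigpoly_integrable tf /trigpoly_integrable tg; exact: RintegralD.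
Qed.

Lemma torus_intZ c f : trigpoly f ->
  torus_int (fun x => c * f x) = c * torus_int f.
Proof. by move=> /trigpoly_integrable tf; exact: RintegralZl. Qed.

Lemma torus_intN f : trigpoly f ->
  torus_int (fun x => - f x) = - torus_int f.
Proof.
move=> tf; rewrite -mulN1r -torus_intZ//; congr torus_int.
by apply/funext => x; rewrite mulN1r.
Qed.

Lemma torus_intB f g : trigpoly f -> trigpoly g ->
  torus_int (fun x => f x - g x) = torus_int f - torus_int g.
Proof. by move=> tf tg; rewrite torus_intD ?torus_intN//; exact: trigpolyN. Qed.

Lemma torus_int_sum (I : Type) (s : seq I) (F : I -> 'rV[R]_d -> R) :
  (forall i, trigpoly (F i)) ->
  torus_int (fun x => \sum_(i <- s) F i x) = \sum_(i <- s) torus_int (F i).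
Proof.
move=> tF; elim: s => [|i s IH].
  by under eq_fun do rewrite big_nil; rewrite torus_int_cst big_nil.
under eq_fun do rewrite big_cons.
by rewrite torus_intD ?IH ?big_cons//; exact: trigpoly_sum.
Qed.

Lemma le_torus_int f g : trigpoly f -> trigpoly g -> (forall x, f x <= g x) ->
  torus_int f <= torus_int g.
Proof.
move=> /trigpoly_integrable tf /trigpoly_integrable tg fg.
by apply: le_Rintegral => // t _; exact: fg.
Qed.

Lemma torus_int_ge0 f : (forall x, 0 <= f x) -> 0 <= torus_int f.
Proof. by move=> f0; apply: Rintegral_ge0 => t _; exact: f0. Qed.

Lemma torus_int_refl f x : trigpoly f -> torus_int (fun z => f (x - z)) = torus_int f.
Proof.
move=> tf; rewrite /torus_int torus_eint_refl//; first exact: trigpoly_periodic.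
by apply: measurable_funTS; exact: trigpoly_measurable.
Qed.

Lemma trigpoly_shift f x : trigpoly f -> trigpoly (fun z => f (x + z)).
Proof.
move=> tf; rewrite (_ : (fun z => _) = (fun z => (fun y => f (x - y)) (0 - z))).
  by apply: (trigpoly_refl (f := fun y => f (x - y))); exact: trigpoly_refl.
by apply/funext => z; rewrite sub0r opprK.
Qed.

Lemma torus_int_shift f x : trigpoly f -> torus_int (fun z => f (x + z)) = torus_int f.
Proof.
move=> tf; rewrite -[RHS](torus_int_refl x)// -[RHS](torus_int_refl 0); last exact: trigpoly_refl.
by congr torus_int; apply/funext => z; rewrite sub0r opprK.
Qed.

Lemma prob_density_trigpoly f : trigpoly f -> (forall x, 0 <= f x) ->
  torus_int f = 1 -> prob_density f.
Proof.
move=> tf f0 f1; split => //; first exact: trigpoly_periodic.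
  exact: trigpoly_measurable.
by rewrite torus_eint_trigpoly// f1.
Qed.

Lemma is_derive_along f x v (s df : R) :
  is_derive (s *: v + x) v f df -> is_derive s (1 : R) (fun h : R => f (h *: v + x)) df.
Proof.
move=> [hd hv].
have E : (fun h : R => h^-1 *: ((f \o shift (s *: v + x)) (h *: v) - f (s *: v + x))) =
  (fun h : R => h^-1 *: (((fun h : R => f (h *: v + x)) \o shift s) (h *: 1)
    - (fun h : R => f (h *: v + x)) s)).
  by apply/funext => h /=; rewrite [h *: 1]mulr1 scalerDl addrA.
by split; [rewrite /derivable -E|rewrite /derive -E].
Qed.

(** The integral of f (s e_i + .) does not depend on s; differentiate it under
    the integral sign at s = 0. *)
Lemma torus_int_pderive i f : trigpoly f -> torus_int (pderive i f) = 0.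
Proof.
move=> tf; have tdf := trigpoly_pderive i tf; have [M hM] := trigpoly_bounded tdf.
pose F (s : R) (t : d.-tuple (measurableTypeR R)) := f (s *: e i + row_of_tuple t).
have Fd s t : is_derive s (1 : R) (F ^~ t) (pderive i f (s *: e i + row_of_tuple t)).
  by apply: is_derive_along; exact: trigpoly_is_derive.
have dF s t : partial1of2 F s t = pderive i f (s *: e i + row_of_tuple t).
  by rewrite partial1of2E; case: (Fd s t).
have M0 : 0 <= M by exact: le_trans (hM 0).
have H := @cvg_differentiation_under_integral R _ _ L F cube mc 0 (-1) 1 _ _ _ (cst M).
have : (h^-1 *: (Rintegral L cube (F (h + 0)) - Rintegral L cube (F 0)))
    @[h --> (0 : R)^'] --> Rintegral L cube (partial1of2 F 0).
  apply: H => //.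
  - by rewrite /= in_itv /=; apply/andP; split; lra.
  - by move=> s _; exact: (trigpoly_integrable (trigpoly_shift (s *: e i) tf)).
  - exact: (trigpoly_integrable (@trigpoly_cst R d M)).
  - by move=> s t _ _; rewrite dF.
have FE s : Rintegral L cube (F s) = torus_int f by rewrite -(torus_int_shift (s *: e i)).
have -> : partial1of2 F 0 = pderive i f \o @row_of_tuple R d.
  by apply/funext => t; rewrite dF scale0r add0r.
under eq_fun do rewrite !FE subrr scaler0.
move=> h1; exact: (cvg_unique (@norm_hausdorff _ _) h1 (cvg_cst 0)).
Qed.

Lemma torus_int_parts i f g : trigpoly f -> trigpoly g ->
  torus_int (fun x => f x * pderive i g x) = - torus_int (fun x => pderive i f x * g x).
Proof.
move=> tf tg; have tdf := trigpoly_pderive i tf; have tdg := trigpoly_pderive i tg.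
apply/eqP; rewrite -addr_eq0 addrC -torus_intD; [|exact: trigpolyM..].
by rewrite -(pderiveM i tf tg) torus_int_pderive//; exact: trigpolyM.
Qed.

(** The change of variables y |-> x - y moves the reflection from the kernel,
    which is only integrable, to the smooth function h. *)
Lemma torus_convE g h x : periodic g -> torus_integrable g -> trigpoly h ->
  torus_conv g h x = torus_int (fun z => g z * h (x - z)).
Proof.
move=> pg ig th; rewrite /torus_conv /torus_int.
rewrite -[in RHS](torus_eint_refl x).
- by congr fine; congr torus_eint; apply/funext => y; rewrite subKr.
- by move=> z k; rewrite pg (trigpoly_periodic (trigpoly_refl x th)).
- apply: measurable_funM.
    by case/integrableP : ig => /measurable_EFinP.
  apply: measurable_funTS.
  exact: (trigpoly_measurable (trigpoly_refl x th)).
Qed.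

Lemma laplacian_refl u x : trigpoly u ->
  laplacian (fun z => - u (x - z)) = fun z => - laplacian u (x - z).
Proof.
move=> tu; apply/funext => z; rewrite /laplacian -sumrN; apply: eq_bigr => i _.
have tdu := trigpoly_pderive i tu.
rewrite (pderiveN i (trigpoly_refl x tu)) (pderive_refl i x tu).
under eq_fun do rewrite opprK.
by rewrite (pderive_refl i x tdu).
Qed.

(** The distributional equation for g tested against z |-> - u (x - z), whose
    Laplacian at z is - Lap u (x - z). *)
Lemma torus_conv_coulomb g u x : coulomb_kernel g -> trigpoly u ->
  torus_conv g (fun y => - laplacian u y) x = u x - torus_int u.
Proof.
move=> [pg ig hg] tu; rewrite torus_convE//; last exact/trigpolyN/trigpoly_laplacian.
have tphi := trigpolyN (trigpoly_refl x tu).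
have := hg _ (trigpoly_test_function tphi).
rewrite (laplacian_refl x tu) subr0 torus_intN; last exact: trigpoly_refl.
rewrite torus_int_refl// => /eqP; rewrite eqr_oppLR => /eqP ->.
by ring.
Qed.

(** With phi z = - u (x - z), the weak gradient is tested against Lap phi, then
    the equation for g against d_i phi; the mean of d_i phi vanishes and its
    value at 0 is d_i u x. *)
Lemma torus_conv_gradient g G u x i : coulomb_kernel g -> weak_gradient g G ->
  trigpoly u -> torus_conv (G i) (fun y => - laplacian u y) x = pderive i u x.
Proof.
move=> [pg ig hg] /(_ i)[pG iG hG] tu.
rewrite torus_convE//; last exact/trigpolyN/trigpoly_laplacian.
have tphi := trigpolyN (trigpoly_refl x tu).
transitivity (torus_int (fun z => G i z * laplacian (fun z => - u (x - z)) z)).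
  by rewrite laplacian_refl.
have := hG _ (trigpoly_test_function (trigpoly_laplacian tphi)).
rewrite (pderive_laplacian i tphi) => /eqP; rewrite -eqr_oppLR.
rewrite (hg _ (trigpoly_test_function (trigpoly_pderive i tphi))).
rewrite torus_int_pderive// subr0 => /eqP <-.
rewrite (pderiveN i (trigpoly_refl x tu)) (pderive_refl i x tu).
by rewrite opprK subr0.
Qed.

End torus_int.

(** * Products of one-variable bumps *)

Section bump.
Context (R : realType) (d : nat).
Implicit Types (f g h u : 'rV[R]_d -> R) (x y z : 'rV[R]_d) (i j : 'I_d).
Notation tau := (pi *+ 2 : R).
Notation cosc := (@cosc R d).
Notation sinc := (@sinc R d).

Lemma tau_gt0 : 0 < tau.
Proof. by rewrite pmulrn_lgt0// pi_gt0. Qed.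

Lemma pderive_prod0 i (s : seq 'I_d) (P : pred 'I_d) (F : 'I_d -> 'rV[R]_d -> R) :
  (forall j, trigpoly (F j)) ->
  (forall j, j \in s -> P j -> pderive i (F j) = fun=> 0) ->
  pderive i (fun x => \prod_(j <- s | P j) F j x) = fun=> 0.
Proof.
move=> tF; elim: s => [|j s IH] dF.
  under eq_fun do rewrite big_nil.
  exact: pderive_cst.
under eq_fun do rewrite big_cons.
have IH' : pderive i (fun x => \prod_(j <- s | P j) F j x) = fun=> 0.
  by apply: IH => k ks; apply: dF; rewrite inE ks orbT.
case Pj : (P j); last exact: IH'.
rewrite (pderiveM i (tF j) (trigpoly_prod s P tF)) IH' dF ?mem_head//.
by apply/funext => x; rewrite mul0r mulr0 addr0.
Qed.

Definition bump1 i x : R := (1 + cosc i x) / 2.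

Lemma trigpoly_bump1 i : trigpoly (bump1 i).
Proof.
apply: trigpolyM; last exact: trigpoly_cst.
by apply: trigpolyD; [exact: trigpoly_cst|exact: trigpoly_cos].
Qed.

Lemma pderive_bump1 i j :
  pderive i (bump1 j) = fun x => - (pi * sinc j x) * (i == j)%:R.
Proof.
rewrite (_ : bump1 j = (fun x => 2^-1 + 2^-1 * cosc j x)); last first.
  by apply/funext => x; rewrite /bump1; lra.
have tc := trigpoly_cos R j.
rewrite (pderiveD i (trigpoly_cst _ _) (trigpolyZ _ tc)) pderive_cst (pderiveZ i _ tc).
by rewrite pderive_cosc; apply/funext => x; field.
Qed.

Lemma bump1_ge0 i x : 0 <= bump1 i x.
Proof. by rewrite /bump1 divr_ge0// -lerBlDl sub0r cos_geN1. Qed.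

Lemma bump1_le1 i x : bump1 i x <= 1.
Proof.
rewrite /bump1 ler_pdivrMr// mul1r.
by have := cos_le1 (tau * x 0 i); rewrite -/(cosc i x); lra.
Qed.

Lemma sinc2E i x : sinc i x ^+ 2 = 4 * bump1 i x * (1 - bump1 i x).
Proof. by rewrite /sinc sin2cos2 /bump1 /cosc; field. Qed.

(** The i-th derivative of sin (2 pi x_i) p_i^m h has zero integral; since
    sin^2 = 4 p_i (1 - p_i) and cos = 2 p_i - 1, where p_i is [bump1 i], it is
    a combination of p_i^m h and p_i^(m + 1) h. *)
Lemma int_bump1_rec i m h : trigpoly h -> pderive i h = (fun=> 0) ->
  torus_int (fun x => bump1 i x ^+ m.+1 * h x) =
  (m.*2.+1)%:R / (m.*2.+2)%:R * torus_int (fun x => bump1 i x ^+ m * h x).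
Proof.
move=> th dh; have tp := trigpoly_bump1 i.
have ts := trigpoly_sin R i.
have tph k : trigpoly (fun x => bump1 i x ^+ k * h x) by apply: trigpolyM => //; exact: trigpolyX.
have := torus_int_pderive i (trigpolyM ts (tph m)).
rewrite (pderiveM i ts (tph m)) (pderiveM i (trigpolyX m tp) th) dh.
rewrite pderive_sinc (pderiveX i m tp) pderive_bump1 eqxx.
rewrite (_ : (fun x => _) = (fun x => tau * (m.*2.+2)%:R * (bump1 i x ^+ m.+1 * h x)
    - tau * (m.*2.+1)%:R * (bump1 i x ^+ m * h x))); last first.
  apply/funext => x.
  have E : m%:R * bump1 i x ^+ m.-1 * sinc i x ^+ 2 = m%:R * 4 * bump1 i x ^+ m * (1 - bump1 i x).
    by rewrite sinc2E; case: m => [|m]; rewrite ?mul0r//= exprS; ring.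
  have E' : cosc i x = 2 * bump1 i x - 1 by rewrite /bump1; field.
  have N2 : (m.*2.+2)%:R = 2 * m%:R + 2 :> R by rewrite -mul2n -addn2 natrD natrM.
  have N1 : (m.*2.+1)%:R = 2 * m%:R + 1 :> R by rewrite -mul2n -addn1 natrD natrM.
  rewrite E' exprS N1 N2.
  transitivity (tau * (2 * bump1 i x - 1) * (bump1 i x ^+ m * h x)
    - pi * h x * (m%:R * bump1 i x ^+ m.-1 * sinc i x ^+ 2)).
    by rewrite ?mulr1n; set q := _ ^+ m.-1; ring.
  by rewrite E; ring.
rewrite torus_intB; try exact: trigpolyZ.
rewrite !torus_intZ// => /eqP; rewrite subr_eq0 => /eqP H.
have p0 : tau != 0 by rewrite gt_eqF// tau_gt0.
have m0 : (m.*2.+2)%:R != 0 :> R by rewrite pnatr_eq0.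
apply: (mulfI (mulf_neq0 p0 m0)); rewrite H.
by move: m0; set b := (m.*2.+2)%:R => m0; field.
Qed.

Definition bump N (s : seq 'I_d) x : R := \prod_(j <- s) bump1 j x ^+ N.

Lemma trigpoly_bump1X N j : trigpoly (fun x => bump1 j x ^+ N).
Proof. exact: trigpolyX (trigpoly_bump1 j). Qed.

Lemma pderive_bump1X N i j : i != j -> pderive i (fun x => bump1 j x ^+ N) = fun=> 0.
Proof.
move=> ij; rewrite (pderiveX i N (trigpoly_bump1 j)) pderive_bump1 (negbTE ij).
by apply/funext => x; rewrite !mulr0.
Qed.

(** The factors are removed one at a time, and each of them power by power,
    with [int_bump1_rec]; what remains is the integral of 1. *)
Lemma torus_int_bump_gt0 N (s : seq 'I_d) : uniq s -> 0 < torus_int (bump N s).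
Proof.
elim: s => [_|i s IH /= /andP[his us]].
  rewrite (_ : bump N [::] = (fun=> 1)) ?torus_int_cst//.
  by apply/funext => x; rewrite /bump big_nil.
have th : trigpoly (bump N s) by exact: trigpoly_prod (trigpoly_bump1X N).
have dh : pderive i (bump N s) = fun=> 0.
  apply: (pderive_prod0 (P := xpredT)) => [j|j js _]; first exact: trigpoly_bump1X.
  by apply: pderive_bump1X; apply: contraNneq his => ->.
rewrite (_ : bump N (i :: s) = (fun x => bump1 i x ^+ N * bump N s x)); last first.
  by apply/funext => x; rewrite /bump big_cons.
suff H m : 0 < torus_int (fun x => bump1 i x ^+ m * bump N s x) by exact: H.
elim: m => [|m IHm].
  by under eq_fun do rewrite expr0 mul1r; exact: IH.
by rewrite int_bump1_rec// mulr_gt0// divr_gt0// ltr0n.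
Qed.

End bump.

(** * Concentration of the gradient of a peak *)

Section concentration.
Context (R : realType) (d n : nat).
Implicit Types (x y z : 'rV[R]_d) (i j : 'I_d).
Notation tau := (pi *+ 2 : R).
Notation cosc := (@cosc R d).
Notation sinc := (@sinc R d).
Notation bump1 := (@bump1 R d).
Notation N := n.+2.

(** The exponent is at least 2, so that the second derivatives of each factor
    involve no negative power. *)
Definition peak : 'rV[R]_d -> R := bump N (index_enum 'I_d).

(** The factor of the peak that does not depend on x_i. *)
Definition peak_rest i x : R := \prod_(j | j != i) bump1 j x ^+ N.

Lemma trigpoly_peak : trigpoly peak.
Proof. exact: trigpoly_prod (@trigpoly_bump1X R d N). Qed.

Lemma trigpoly_peak_rest i : trigpoly (peak_rest i).
Proof. exact: trigpoly_prod (@trigpoly_bump1X R d N). Qed.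

Lemma pderive_peak_rest i : pderive i (peak_rest i) = fun=> 0.
Proof.
apply: (pderive_prod0 (P := fun j => j != i)) => [j|j _ ji].
  exact: trigpoly_bump1X.
by apply: pderive_bump1X; rewrite eq_sym.
Qed.

Lemma peakE i : peak = fun x => bump1 i x ^+ N * peak_rest i x.
Proof. by apply/funext => x; rewrite /peak /bump (bigD1 i). Qed.

Lemma pderive_peak i : pderive i peak =
  fun x => - (N%:R * pi) * sinc i x * bump1 i x ^+ n.+1 * peak_rest i x.
Proof.
rewrite (peakE i) (pderiveM i (trigpoly_bump1X R N i) (trigpoly_peak_rest i)).
rewrite pderive_peak_rest (pderiveX i N (trigpoly_bump1 R i)) pderive_bump1 eqxx.
by apply/funext => x /=; rewrite mulr1n; ring.
Qed.

Lemma pderive2_peak i : pderive i (pderive i peak) = fun x =>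
  2 * N%:R * pi ^+ 2 * (bump1 i x ^+ n.+1 * peak_rest i x) * (N%:R * (1 - cosc i x) - 1).
Proof.
have tp := trigpoly_bump1 R i; have ts := trigpoly_sin R i.
have tpn := trigpolyX n.+1 tp; have tr := trigpoly_peak_rest i.
rewrite pderive_peak (_ : (fun x => _) = (fun x => - (N%:R * pi) *
  ((sinc i x * bump1 i x ^+ n.+1) * peak_rest i x))); last first.
  by apply/funext => x; ring.
rewrite (pderiveZ i _ (trigpolyM (trigpolyM ts tpn) tr)) (pderiveM i (trigpolyM ts tpn) tr).
rewrite (pderiveM i ts tpn) pderive_peak_rest pderive_sinc (pderiveX i n.+1 tp) pderive_bump1 eqxx.
apply/funext => x /=; rewrite mulr1n.
have E' : cosc i x = 2 * bump1 i x - 1 by rewrite /bump1; field.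
transitivity (- (N%:R * pi) * (tau * cosc i x * bump1 i x ^+ n.+1
   - n.+1%:R * bump1 i x ^+ n * pi * sinc i x ^+ 2) * peak_rest i x); first by ring.
rewrite sinc2E E' exprS -(natr1 n.+1).
by ring.
Qed.

(** The first order differential equation satisfied by the peak; unlike the
    logarithmic derivative it also makes sense at the zeros of the peak. *)
Lemma sinc_pderive_peak i x :
  sinc i x * pderive i peak x = - tau * N%:R * (1 - cosc i x) * peak x.
Proof.
rewrite pderive_peak (peakE i).
transitivity (- (N%:R * pi) * bump1 i x ^+ n.+1 * peak_rest i x * sinc i x ^+ 2); first by ring.
have E' : cosc i x = 2 * bump1 i x - 1 by rewrite /bump1; field.
by rewrite sinc2E E' (exprS _ n.+1); ring.
Qed.

(** The same equation solved for sin (2 pi x_i) w, for use in the case i = j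
    below. *)
Lemma sinc_peak i x :
  tau * N%:R * (sinc i x * peak x) = - (1 + cosc i x) * pderive i peak x.
Proof.
rewrite pderive_peak (peakE i).
have E' : cosc i x = 2 * bump1 i x - 1 by rewrite /bump1; field.
by rewrite E' (exprS _ n.+1); ring.
Qed.

(** The weight (d_i w)^2 vanishes to second order where x_i = 0, and this
    triples the mean value of 1 - cos (2 pi x_j) when i = j. *)
Definition mean_factor i j : R := if i == j then 3 else 1.

(** Differentiate [sinc_pderive_peak] for the index j with respect to x_i.  For
    i = j a term in sin (2 pi x_j) w appears, which [sinc_peak] turns back into
    a multiple of d_j w. *)
Lemma sinc_pderive2_peak i j x :
  2 * (sinc j x * pderive j (pderive i peak) x) =
  tau * (mean_factor i j - (2 * N%:R + 1) * (1 - cosc j x) - cosc j x) * pderive i peak x.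
Proof.
have tw := trigpoly_peak; have tdj := trigpoly_pderive j tw.
have ts := trigpoly_sin R j; have tc := trigpoly_cos R j.
have t1c : trigpoly (fun x => 1 - cosc j x) by apply: trigpolyB => //; exact: trigpoly_cst.
have := congr1 (fun h => pderive i h x) (funext (sinc_pderive_peak j)).
rewrite (pderiveM i ts tdj).
rewrite (_ : (fun x => - tau * N%:R * (1 - cosc j x) * peak x) =
   (fun x => - tau * N%:R * ((1 - cosc j x) * peak x))); last first.
  by apply/funext => y; rewrite !mulrA.
rewrite (pderiveZ i _ (trigpolyM t1c tw)) (pderiveM i t1c tw).
rewrite (pderiveD i (trigpoly_cst _ _) (trigpolyN tc)) (pderiveN i tc) pderive_cst.
rewrite pderive_cosc pderive_sinc (pderiveC j i tw) => H.
have -> : sinc j x * pderive i (pderive j peak) x =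
  - tau * N%:R * ((tau * sinc j x * (i == j)%:R) * peak x + (1 - cosc j x) * pderive i peak x)
  - tau * cosc j x * (i == j)%:R * pderive j peak x.
  apply/eqP; rewrite -subr_eq0; move/eqP: H; rewrite -subr_eq0 => /eqP H.
  by rewrite -H; apply/eqP; ring.
rewrite /mean_factor; have [->|ij] := eqVneq i j; last by rewrite /=; ring.
have := sinc_peak j x; move=> S.
transitivity (- 2 * tau * (tau * N%:R * (sinc j x * peak x)) +
  2 * (- tau * N%:R * (1 - cosc j x) * pderive j peak x)
  - 2 * tau * cosc j x * pderive j peak x); first by rewrite /= mulr1n; ring.
by rewrite S; ring.
Qed.

(** The integral of d_j (sin (2 pi x_j) (d_i w)^2) vanishes, and the integrand
    is 2 pi (d_i w)^2 (mean_factor - (2 N + 1) (1 - cos (2 pi x_j))). *)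
Lemma int_concentration i j :
  (2 * N%:R + 1) * torus_int (fun x => pderive i peak x ^+ 2 * (1 - cosc j x)) =
  mean_factor i j * torus_int (fun x => pderive i peak x ^+ 2).
Proof.
have tdi := trigpoly_pderive i trigpoly_peak; have tdi2 := trigpolyX 2 tdi.
have ts := trigpoly_sin R j; have tc := trigpoly_cos R j.
have t1c : trigpoly (fun x => 1 - cosc j x) by apply: trigpolyB => //; exact: trigpoly_cst.
have := torus_int_pderive j (trigpolyM ts tdi2).
rewrite (pderiveM j ts tdi2) (pderiveX j 2 tdi) pderive_sinc eqxx.
rewrite (_ : (fun x => _) = (fun x => tau * mean_factor i j * pderive i peak x ^+ 2
  - tau * (2 * N%:R + 1) * (pderive i peak x ^+ 2 * (1 - cosc j x)))); last first.
  apply/funext => x /=; rewrite mulr1n.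
  transitivity (tau * cosc j x * pderive i peak x ^+ 2 +
    pderive i peak x * (2 * (sinc j x * pderive j (pderive i peak) x))); first by ring.
  by rewrite sinc_pderive2_peak; ring.
have t2 := trigpolyM tdi2 t1c.
rewrite torus_intB; [|exact: trigpolyZ..].
rewrite !torus_intZ// => /eqP; rewrite subr_eq0 -!mulrA => /eqP.
by move=> /(mulfI (lt0r_neq0 (tau_gt0 R))) ->.
Qed.

End concentration.

(** * The target density *)

Section target.
Context (R : realType) (d : nat).
Hypothesis hd : (1 <= d)%N.
Implicit Types (x y z : 'rV[R]_d) (i j : 'I_d).
Notation tau := (pi *+ 2 : R).
Notation cosc := (@cosc R d).
Notation sinc := (@sinc R d).
Notation bump1 := (@bump1 R d).

(** The density mu of the statement. *)
Definition target x : R := d%:R^-1 * \sum_(i < d) (1 - cosc i x).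

Let d_gt0 : 0 < d%:R :> R.
Proof. by rewrite ltr0n. Qed.

Lemma trigpoly_1Bcosc i : trigpoly (fun x => 1 - cosc i x).
Proof. by apply: trigpolyB; [exact: trigpoly_cst|exact: trigpoly_cos]. Qed.

Lemma cosc_le1 i x : cosc i x <= 1.
Proof. exact: cos_le1. Qed.

Lemma trigpoly_target : trigpoly target.
Proof. by apply: trigpolyZ; apply: trigpoly_sum => i; exact: trigpoly_1Bcosc. Qed.

Lemma target_ge0 x : 0 <= target x.
Proof.
by rewrite mulr_ge0 ?invr_ge0 ?ler0n// sumr_ge0// => i _; rewrite subr_ge0 cosc_le1.
Qed.

Lemma torus_int_cosc i : torus_int (cosc i) = 0.
Proof.
have := torus_int_pderive i (trigpoly_sin R i).
rewrite pderive_sinc eqxx (_ : (fun x => _) = (fun x => tau * cosc i x)); last first.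
  by apply/funext => x; rewrite mulr1.
rewrite torus_intZ; last exact: trigpoly_cos.
by move/eqP; rewrite mulf_eq0 (gt_eqF (tau_gt0 R))/= => /eqP.
Qed.

Lemma torus_int_target : torus_int target = 1.
Proof.
rewrite torus_intZ; last by apply: trigpoly_sum => i; exact: trigpoly_1Bcosc.
rewrite torus_int_sum; last exact: trigpoly_1Bcosc.
rewrite (eq_bigr (fun=> 1)) => [|i _].
  by rewrite sumr_const card_ord mulVf// gt_eqF.
rewrite torus_intB ?torus_int_cosc ?torus_int_cst ?subr0//; last exact: trigpoly_cos.
exact: trigpoly_cst.
Qed.

Lemma target_eq0 x : target x = 0 <-> exists k, x = 0 + lattice_vec R k.
Proof.
split=> [|[k ->]]; last first.
  rewrite (trigpoly_periodic trigpoly_target) /target big1 ?mulr0// => i _.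
  by rewrite /cosc mxE mulr0 cos0 subrr.
move=> /eqP; rewrite mulf_eq0 invr_eq0 (gt_eqF d_gt0)/= psumr_eq0; last first.
  by move=> i _; rewrite subr_ge0 cosc_le1.
move=> /allP h.
have c1 i : cos (tau * x 0 i) = 1.
  by have := h i (mem_index_enum _); rewrite subr_eq0 => /eqP.
exists (\row_i projT1 (cid (cos_2pi_eq1 (c1 i)))).
by apply/rowP => i; rewrite !mxE add0r; case: cid.
Qed.

Lemma lipschitz_target : lipschitz target.
Proof.
have [K K0 hK] := trigpoly_lipschitz trigpoly_target.
apply: (@klipschitzW _ _ _ K).
  exact: (@globally_properfilter _ _ (0 : 'rV[R]_d, 0 : 'rV[R]_d)).
by move=> [x y] _ /=; exact: hK.
Qed.

Section peak_estimates.
Variable n : nat.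
Notation N := n.+2.
Let w : 'rV[R]_d -> R := @peak R d n.

Let tw : trigpoly w := trigpoly_peak R d n.
Let tdw i : trigpoly (pderive i w) := trigpoly_pderive i tw.
Let tdw2 i : trigpoly (fun x => pderive i w x ^+ 2) := trigpolyX 2 (tdw i).

(** Each second derivative of w is 2 N pi^2 q (N (1 - cos (2 pi x_i)) - 1)
    with 0 <= q <= 1.  The term - 1, which makes w concave at its maximum, is
    what allows a bound that vanishes where the target does. *)
Lemma laplacian_peak_le x :
  laplacian w x <= 2 * N%:R ^+ 2 * pi ^+ 2 * d%:R * target x.
Proof.
rewrite /target mulrA mulfK ?gt_eqF// mulr_sumr; apply: ler_sum => i _.
rewrite pderive2_peak.
set q := bump1 i x ^+ n.+1 * peak_rest n i x.
have q0 : 0 <= q.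
  by rewrite mulr_ge0 ?exprn_ge0 ?bump1_ge0// prodr_ge0// => j _; rewrite exprn_ge0 ?bump1_ge0.
have q1 : q <= 1.
  have b1 m j : bump1 j x ^+ m <= 1 by rewrite exprn_ile1 ?bump1_ge0 ?bump1_le1.
  rewrite mulr_ile1 ?exprn_ge0 ?bump1_ge0//.
    by rewrite prodr_ge0// => j _; rewrite exprn_ge0 ?bump1_ge0.
  by apply: prodr_ile1 => j _; rewrite exprn_ge0 ?bump1_ge0//= b1.
have c1 : 0 <= 1 - cosc i x by rewrite subr_ge0 cosc_le1.
have N1 : 1 <= N%:R :> R by rewrite ler1n.
set r := 1 - cosc i x in c1 *.
have -> : 2 * N%:R ^+ 2 * pi ^+ 2 * r = 2 * N%:R * pi ^+ 2 * (N%:R * r) :> R by ring.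
rewrite -mulrA ler_pM2l ?mulr_gt0 ?exprn_gt0 ?pi_gt0 ?ltr0n//.
have Nr : 0 <= N%:R * r by rewrite mulr_ge0.
apply: (@le_trans _ _ (q * (N%:R * r))); first by rewrite ler_wpM2l// gerBl.
by rewrite ler_piMl.
Qed.

Lemma int_target_pderive_peak i :
  torus_int (fun x => pderive i w x ^+ 2 * target x) =
  (d%:R * (2 * N%:R + 1))^-1 * (\sum_(j < d) mean_factor R i j) *
     torus_int (fun x => pderive i w x ^+ 2).
Proof.
have N1 : 2 * N%:R + 1 != 0 :> R by rewrite gt_eqF// ltr_wpDl.
have dN : d%:R != 0 :> R by rewrite gt_eqF.
have tj j := trigpolyM (tdw2 i) (trigpoly_1Bcosc j).
rewrite (_ : (fun x => _) = (fun x =>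
    d%:R^-1 * \sum_(j < d) pderive i w x ^+ 2 * (1 - cosc j x))); last first.
  by apply/funext => x; rewrite /target mulrCA mulr_sumr.
rewrite torus_intZ; last exact: trigpoly_sum.
rewrite (torus_int_sum (index_enum _) tj) invfM -!mulrA; congr (_ * _).
rewrite mulr_suml mulr_sumr; apply: eq_bigr => j _.
by rewrite -int_concentration mulKf.
Qed.

Lemma mean_factor_bounds i j : 1 <= mean_factor R i j <= 3.
Proof. by rewrite /mean_factor; case: ifP => _; apply/andP; split; lra. Qed.

Let energy_ge0 i : 0 <= torus_int (fun x => pderive i w x ^+ 2).
Proof. by apply: torus_int_ge0 => x; rewrite sqr_ge0. Qed.

Let coef_bounds i : (2 * N%:R + 1)^-1 <=
    (d%:R * (2 * N%:R + 1))^-1 * (\sum_(j < d) mean_factor R i j) <= 3 / (2 * N%:R + 1).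
Proof.
have N0 : 0 < 2 * N%:R + 1 :> R by rewrite ltr_wpDl.
have sk (c : R) : \sum_(j < d) c = d%:R * c by rewrite sumr_const card_ord mulr_natl.
rewrite invfM mulrAC; apply/andP; split.
  rewrite ler_peMl ?invr_ge0 ?(ltW N0)// ler_pdivlMl// -sk.
  by apply: ler_sum => j _; have /andP[] := mean_factor_bounds i j.
rewrite ler_pM2r ?invr_gt0// ler_pdivrMl// -sk.
by apply: ler_sum => j _; have /andP[] := mean_factor_bounds i j.
Qed.

Lemma int_target_pderive_peak_le i :
  torus_int (fun x => pderive i w x ^+ 2 * target x) <=
  3 / (2 * N%:R + 1) * torus_int (fun x => pderive i w x ^+ 2).
Proof.
by rewrite int_target_pderive_peak ler_wpM2r//; have /andP[] := coef_bounds i.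
Qed.

Lemma int_target_pderive_peak_ge i :
  (2 * N%:R + 1)^-1 * torus_int (fun x => pderive i w x ^+ 2) <=
  torus_int (fun x => pderive i w x ^+ 2 * target x).
Proof.
by rewrite int_target_pderive_peak ler_wpM2r//; have /andP[] := coef_bounds i.
Qed.

(** Let A be the integral of sin (2 pi x_i) d_i w.  Integration by parts
    expresses A through the integral of cos (2 pi x_i) w, and
    [sinc_pderive_peak] through the integral of (1 - cos (2 pi x_i)) w; as w
    has positive integral, A <> 0.  Cauchy-Schwarz, in the form of the
    nonnegativity of the integral of (d_i w - A sin (2 pi x_i))^2, concludes. *)
Lemma int_pderive_peak_gt0 i : 0 < torus_int (fun x => pderive i w x ^+ 2).
Proof.
have ts := trigpoly_sin R i; have tc := trigpoly_cos R i.
have W0 : 0 < torus_int w by apply: torus_int_bump_gt0; exact: index_enum_uniq.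
pose A := torus_int (fun x => sinc i x * pderive i w x).
have tsw := trigpolyM ts (tdw i); have tcw := trigpolyM tc tw.
have A1 : A = - (tau * torus_int (fun x => cosc i x * w x)).
  rewrite /A torus_int_parts// -torus_intZ//; congr (- torus_int _).
  by rewrite pderive_sinc eqxx; apply/funext => x; rewrite mulr1 mulrA.
have A2 : A = - (tau * N%:R) * (torus_int w - torus_int (fun x => cosc i x * w x)).
  rewrite -torus_intB// -torus_intZ; last exact: trigpolyB.
  by congr torus_int; apply/funext => x; rewrite sinc_pderive_peak -/w; ring.
have AN : A != 0.
  apply/eqP => A0; move: A1; rewrite A0 => /esym/eqP.
  rewrite oppr_eq0 mulf_eq0 (gt_eqF (tau_gt0 R))/= => /eqP C0.
  move: A2; rewrite A0 C0 subr0 => /esym/eqP.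
  by rewrite mulf_eq0 oppr_eq0 mulf_eq0 (gt_eqF (tau_gt0 R)) pnatr_eq0 (gt_eqF W0).
have ts2 := trigpolyX 2 ts.
have S1 : torus_int (fun x => sinc i x ^+ 2) <= 1.
  rewrite -[leRHS](torus_int_cst d) le_torus_int//; first exact: trigpoly_cst.
  by move=> x; rewrite /sinc sin2cos2 gerBl sqr_ge0.
have : 0 <= torus_int (fun x => (pderive i w x - A * sinc i x) ^+ 2).
  by apply: torus_int_ge0 => x; rewrite sqr_ge0.
rewrite (_ : (fun x => _) = (fun x => pderive i w x ^+ 2 +
   (A ^+ 2 * sinc i x ^+ 2 - 2 * A * (sinc i x * pderive i w x)))); last first.
  by apply/funext => x; ring.
have t1 : trigpoly (fun x => A ^+ 2 * sinc i x ^+ 2) by exact: trigpolyZ.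
have t2 : trigpoly (fun x => 2 * A * (sinc i x * pderive i w x)) by exact: trigpolyZ.
rewrite torus_intD//; last exact: trigpolyB.
rewrite torus_intB// !torus_intZ// -/A => H.
have A0 : 0 < A ^+ 2 by rewrite exprn_even_gt0.
have : A ^+ 2 * torus_int (fun x => sinc i x ^+ 2) <= A ^+ 2 by rewrite ler_piMr// ltW.
by nra.
Qed.

End peak_estimates.
End target.

(** * Perturbing the target density *)

Section perturbation.
Context (R : realType) (d : nat) (g : 'rV[R]_d -> R) (G : 'I_d -> 'rV[R]_d -> R).
Hypotheses (hg : coulomb_kernel g) (hG : weak_gradient g G).
Implicit Types (u mu : 'rV[R]_d -> R).

Definition grad2 u (x : 'rV[R]_d) : R := \sum_(i < d) pderive i u x ^+ 2.

Lemma trigpoly_grad2 u : trigpoly u -> trigpoly (grad2 u).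
Proof. by move=> tu; apply: trigpoly_sum => i; apply/trigpolyX/trigpoly_pderive. Qed.

Lemma grad2_ge0 u x : 0 <= grad2 u x.
Proof. by apply: sumr_ge0 => i _; rewrite sqr_ge0. Qed.

Let diffE u mu : (fun x => (mu x - laplacian u x) - mu x) = (fun x => - laplacian u x).
Proof. by apply/funext => x; rewrite addrAC subrr sub0r. Qed.

Lemma torus_int_laplacian u : trigpoly u -> torus_int (laplacian u) = 0.
Proof.
move=> tu; rewrite torus_int_sum; last by move=> i; do 2 apply: trigpoly_pderive.
by rewrite big1// => i _; rewrite torus_int_pderive//; exact: trigpoly_pderive.
Qed.

(** int (u - int u) (- Lap u) = int |grad u|^2 by parts. *)
Lemma MMD2_laplacian u mu : trigpoly u ->
  MMD2 g (fun x => mu x - laplacian u x) mu = (2^-1 * torus_int (grad2 u))%:E.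
Proof.
move=> tu; rewrite /MMD2; cbv zeta; rewrite diffE EFinM; congr (_ * _)%E.
have tl := trigpoly_laplacian tu; have tdu i := trigpoly_pderive i tu.
pose v x := u x - torus_int u.
have tv : trigpoly v by apply: trigpolyB => //; exact: trigpoly_cst.
transitivity (torus_eint (fun x => v x * - laplacian u x)).
  congr torus_eint; apply/funext => x.
  by rewrite (torus_conv_coulomb _ hg tu) addrAC subrr sub0r.
rewrite torus_eint_trigpoly; last exact: (trigpolyM tv (trigpolyN tl)).
congr EFin.
transitivity (torus_int (fun x => \sum_(i < d) - (v x * pderive i (pderive i u) x))).
  congr torus_int; apply/funext => x.
  by rewrite mulrN /laplacian mulr_sumr sumrN.
rewrite torus_int_sum => [|i]; last exact/trigpolyN/(trigpolyM tv)/trigpoly_pderive.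
rewrite [RHS]torus_int_sum => [|i]; last exact: trigpolyX.
apply: eq_bigr => i _.
rewrite torus_intN; last exact/(trigpolyM tv)/trigpoly_pderive.
rewrite torus_int_parts// opprK; congr torus_int; apply/funext => x.
rewrite /v (pderiveD i tu (trigpolyN (trigpoly_cst _ _))) (pderiveN i (trigpoly_cst _ _)).
by rewrite pderive_cst oppr0 addr0 expr2.
Qed.

Lemma dissipation_laplacian u mu : trigpoly u -> trigpoly mu ->
  dissipation G (fun x => mu x - laplacian u x) mu =
  (torus_int (fun x => grad2 u x * (mu x - laplacian u x)))%:E.
Proof.
move=> tu tmu; rewrite /dissipation; cbv zeta; rewrite diffE.
rewrite -torus_eint_trigpoly; last first.
  by apply: trigpolyM; [exact: trigpoly_grad2|apply: trigpolyB => //; exact: trigpoly_laplacian].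
congr torus_eint; apply/funext => x; congr (_ * _).
by apply: eq_bigr => i _; rewrite (torus_conv_gradient x i hg hG tu).
Qed.

Hypothesis hd : (1 <= d)%N.

(** The density is rho = mu - a Lap w with a so small that both
    a Lap w <= mu / 2, which gives mu / 2 <= rho, and - a Lap w <= 1 / (n + 1),
    so that rho <= mu + 1 / (n + 1).  With E = int |grad u|^2, the latter and
    the concentration of |grad w|^2 bound D by (3 + 1) E / (n + 1). *)
Lemma concentrated_density n : exists rho (E D : R),
  [/\ prob_density rho, MMD2 g rho (@target R d) = (E / 2)%:E,
      dissipation G rho (@target R d) = D%:E, 0 < D & D * n.+1%:R <= 4 * E].
Proof.
pose w : 'rV[R]_d -> R := @peak R d n; have tw : trigpoly w by exact: trigpoly_peak.
have tmu := @trigpoly_target R d.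
have [M hM] := trigpoly_bounded (trigpoly_laplacian tw).
have M0 : 0 <= M by exact: le_trans (hM 0).
pose C : R := 2 * n.+2%:R ^+ 2 * pi ^+ 2 * d%:R.
have C0 : 0 <= C by do 3 (apply: mulr_ge0; last by rewrite ?sqr_ge0 ?ler0n).
(* small enough for a C <= 1/2 and for (n + 1) a M <= 1 *)
pose a : R := (2 * C + n.+1%:R * M + 1)^-1.
have den0 : 0 < 2 * C + n.+1%:R * M + 1.
  by rewrite ltr_wpDl// addr_ge0// mulr_ge0.
have a0 : 0 < a by rewrite invr_gt0.
have aden : a * (2 * C + n.+1%:R * M + 1) = 1 by rewrite mulVf// gt_eqF.
have aC : a * C <= 2^-1.
  have : 0 <= a * (n.+1%:R * M) by rewrite mulr_ge0 ?mulr_ge0// ltW.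
  by move: aden; rewrite !mulrDr; nra.
have aM : n.+1%:R * (a * M) <= 1.
  have : 0 <= a * (2 * C) by apply: mulr_ge0; [exact: ltW|apply: mulr_ge0].
  by move: aden; rewrite !mulrDr mulrCA; nra.
pose u x := a * w x.
have tu : trigpoly u by exact: trigpolyZ.
have tdw i := trigpoly_pderive i tw.
have du i : pderive i u = fun x => a * pderive i w x by exact: pderiveZ.
have lapu x : laplacian u x = a * laplacian w x.
  rewrite /laplacian mulr_sumr; apply: eq_bigr => i _.
  by rewrite du (pderiveZ i a (tdw i)).
pose rho x := target x - laplacian u x.
have trho : trigpoly rho by apply: trigpolyB => //; exact: trigpoly_laplacian.
have rho_ge x : 2^-1 * target x <= rho x.
  have t0 := target_ge0 x; have := laplacian_peak_le hd n x; rewrite -/C -/w.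
  move=> h; have : a * laplacian w x <= a * (C * target x) by rewrite ler_pM2l.
  have : a * C * target x <= 2^-1 * target x by rewrite ler_wpM2r.
  by rewrite /rho lapu; lra.
have rho_le x : n.+1%:R * rho x <= n.+1%:R * target x + 1.
  have : - laplacian w x <= M by rewrite (le_trans _ (hM x))// ler_normr lexx orbT.
  move=> h; have : a * - laplacian w x <= a * M by rewrite ler_pM2l.
  rewrite mulrN => h'; have : n.+1%:R * - (a * laplacian w x) <= n.+1%:R * (a * M).
    by rewrite ler_pM2l.
  by rewrite /rho lapu; lra.
have tg := trigpoly_grad2 tu.
have tgm := trigpolyM tg tmu; have tgr := trigpolyM tg trho.
pose e i := torus_int (fun x => pderive i w x ^+ 2).
pose m i := torus_int (fun x => pderive i w x ^+ 2 * target x).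
have EE : torus_int (grad2 u) = a ^+ 2 * \sum_(i < d) e i.
  rewrite torus_int_sum => [|i]; last exact/trigpolyX/trigpoly_pderive.
  rewrite mulr_sumr; apply: eq_bigr => i _; rewrite -torus_intZ; last exact: trigpolyX.
  by congr torus_int; rewrite du; apply/funext => x; rewrite exprMn.
have ME : torus_int (fun x => grad2 u x * target x) = a ^+ 2 * \sum_(i < d) m i.
  rewrite (_ : (fun x => _) = (fun x => \sum_(i < d) pderive i u x ^+ 2 * target x)); last first.
    by apply/funext => x; rewrite mulr_suml.
  have t2 i : trigpoly (fun x => pderive i w x ^+ 2 * target x) by apply/trigpolyM/tmu/trigpolyX.
  rewrite torus_int_sum => [|i]; last exact/trigpolyM/tmu/trigpolyX/trigpoly_pderive.
  rewrite mulr_sumr; apply: eq_bigr => i _; rewrite -torus_intZ//.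
  by congr torus_int; rewrite du; apply/funext => x; rewrite exprMn mulrA.
set E := torus_int (grad2 u) in EE *.
set Mu := torus_int (fun x => grad2 u x * target x) in ME *.
exists rho, E, (torus_int (fun x => grad2 u x * rho x)); split.
- apply: prob_density_trigpoly => //.
    move=> x; apply: le_trans (rho_ge x); rewrite mulr_ge0 ?target_ge0//.
  rewrite torus_intB//; last exact: trigpoly_laplacian.
  by rewrite torus_int_target// torus_int_laplacian// subr0.
- by rewrite MMD2_laplacian// mulrC.
- exact: dissipation_laplacian.
- have : 2^-1 * Mu <= torus_int (fun x => grad2 u x * rho x).
    rewrite -torus_intZ//; apply: le_torus_int => //; first exact: trigpolyZ.
    by move=> x; rewrite mulrCA ler_wpM2l ?grad2_ge0.
  apply: lt_le_trans; rewrite mulr_gt0// ME mulr_gt0 ?exprn_gt0//.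
  rewrite (bigD1 (Ordinal hd))//= ltr_pwDl//.
    apply: lt_le_trans (int_target_pderive_peak_ge R hd n _).
    by rewrite mulr_gt0 ?int_pderive_peak_gt0// invr_gt0 ltr_wpDl.
  apply: sumr_ge0 => i _; apply: torus_int_ge0 => x.
  by rewrite mulr_ge0 ?sqr_ge0 ?target_ge0.
- have h1 : n.+1%:R * torus_int (fun x => grad2 u x * rho x) <= n.+1%:R * Mu + E.
    rewrite -!torus_intZ// -torus_intD//; last exact: trigpolyZ.
    apply: le_torus_int => [||x]; [exact: trigpolyZ|by apply: trigpolyD => //; exact: trigpolyZ|].
    have -> : n.+1%:R * (grad2 u x * target x) + grad2 u x =
        grad2 u x * (n.+1%:R * target x + 1) by ring.
    by rewrite mulrCA ler_wpM2l ?grad2_ge0.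
  have h2 : n.+1%:R * Mu <= 3 * E.
    rewrite ME EE !(mulrCA _ (a ^+ 2)) ler_pM2l ?exprn_gt0// !mulr_sumr.
    apply: ler_sum => i _.
    have e0 : 0 < e i by exact: int_pderive_peak_gt0.
    have := int_target_pderive_peak_le R hd n i; rewrite -/w -/(m i) -/(e i) => hm.
    have N0 : 0 < 2 * n.+2%:R + 1 :> R by rewrite ltr_wpDl.
    apply: (@le_trans _ _ (n.+1%:R * (3 / (2 * n.+2%:R + 1) * e i))); first by rewrite ler_pM2l.
    rewrite mulrA ler_pM2r// mulrA ler_pdivrMr// mulrC ler_pM2l//.
    have : n.+1%:R <= n.+2%:R :> R by rewrite ler_nat.
    have : 0 <= n.+2%:R :> R by [].
    by lra.
  by rewrite mulrC; lra.
Qed.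
End perturbation.

Theorem proposition1p10 (R : realType) (d : nat) (hd : (1 <= d)%N)
    (g : 'rV[R]_d -> R) (G : 'I_d -> 'rV[R]_d -> R)
    (hg : coulomb_kernel g) (hG : weak_gradient g G) :
  exists mu : 'rV[R]_d -> R,
    [/\ prob_density mu,
        lipschitz mu,
        (exists x0 : 'rV[R]_d, forall x,
          mu x = 0 <-> exists k, x = x0 + lattice_vec R k),
        (exists rho : R -> 'rV[R]_d -> R,
          (forall delta, 0 < delta -> prob_density (rho delta)) /\
          fine (MMD2 g (rho delta) mu) / fine (dissipation G (rho delta) mu)
            @[delta --> 0^'+] --> +oo) &
        (forall eps : R, 0 < eps ->
          exists rho : 'rV[R]_d -> R, prob_density rho /\
            ((eps^-1)%:E * dissipation G rho mu <= MMD2 g rho mu)%E)].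
Proof.
have dens n := concentrated_density hg hG hd n.
exists (@target R d); split.
- apply: prob_density_trigpoly; first exact: trigpoly_target.
    exact: target_ge0.
  exact: torus_int_target.
- exact: lipschitz_target.
- by exists 0 => x; exact: target_eq0.
- have [r hr] := choice dens.
  (* the exponent of the peak grows like 1 / delta *)
  exists (fun delta => r (Num.truncn delta^-1)); split.
    by move=> delta _; have [E [D []]] := hr (Num.truncn delta^-1).
  apply/cvgryPge => A.
  have A1 : 0 < `|A| + 1 by rewrite ltr_wpDl.
  near=> delta.
  have [E [D [_ -> -> D0 DE]]] := hr (Num.truncn delta^-1).
  rewrite /= ler_pdivlMr//.
  have dlt : delta^-1 <= (Num.truncn delta^-1).+1%:R by rewrite ltW// truncnS_gt.
  have A8 : 8 * A <= delta^-1.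
    have d0 : 0 < delta by [].
    apply: (@le_trans _ _ (8 * (`|A| + 1))); first by have := ler_norm A; lra.
    rewrite -[leLHS]invrK lef_pV2 ?posrE ?invr_gt0 ?mulr_gt0//.
    by near: delta; apply: nbhs_right_le; rewrite invr_gt0 mulr_gt0.
  have : D * (8 * A) <= 4 * E.
    by apply: le_trans DE; rewrite ler_pM2l// (le_trans A8).
  by lra.
- move=> eps eps0.
  have [rho [E [D [prho mE dE D0 DE]]]] := dens (Num.truncn (8 / eps)).
  exists rho; split => //; rewrite mE dE -EFinM lee_fin.
  have e8 : 8 / eps <= (Num.truncn (8 / eps)).+1%:R by rewrite ltW// truncnS_gt.
  have : D * (8 / eps) <= 4 * E by apply: le_trans DE; rewrite ler_pM2l.
  by rewrite mulrCA; lra.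
Unshelve. all: by end_near. Qed.
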